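(* Let $\psi\in\{\psi_{HD},\psi_{HR},\psi_{QO}\}$, let $D>0$ be a fixed constant, and let $\bar\psi$ be given by either (SH1) or (SH2). Let $\gamma=\gamma(\eta)\in(0,\alpha_{\max}]$ for $\eta>0$, and let $\alpha_*$ be selected as $$\alpha_*=\alpha_*(\delta,\eta)\in\operatorname*{argmin}_{\alpha\in[\gamma(\eta),\alpha_{\max}]}\bar\psi(\alpha,A_\eta,y_\delta).$$ Suppose that: (i) (noise condition) there is a constant $C_{nc}>0$ such that for all noisy data $y_\delta$ in the family, $$\|(A^*A+\alpha I)^{-1}A^*(y_\delta-y)\|\le C_{nc}\,\psi(\alpha,A,y_\delta-y)\qquad\forall\,\alpha\in(0,\alpha_{\max}];$$ (ii) there is a constant $C>0$, independent of $\delta$ and $\eta$ (not necessarily the same in the two cases), such that $\|y_\delta\|\ge C$ if $\psi\in\{\psi_{HD},\psi_{HR}\}$, and $\|A_\eta^*y_\delta\|\ge C$ if $\psi=\psi_{QO}$; (iii) $\eta/\sqrt{\gamma(\eta)}\to0$ as $\eta\to0$; (iv) there is a constant $C'$ such that $\eta/\gamma(\eta)\le C'$ as $\eta\to0$. Then $$\|x_{\alpha_*,\delta,\eta}-x^\dagger\|\to0\qquad\text{as }\delta,\eta\to0.$$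
   Context: Setting. $X,Y$ are Hilbert spaces, $A\in\mathcal L(X,Y)$ is a bounded linear operator with non-closed range, assumed injective. $y\in Y$ is the exact data, and $x^\dagger\in X$ is the minimum-norm least squares solution of $Ax=y$; the exact data are attainable, i.e. $y=Ax^\dagger$. $\alpha_{\max}>0$ is fixed. $(y_\delta)_{\delta>0}\subset Y$ is a family of noisy data with $\|y_\delta-y\|\le\delta$, and $(A_\eta)_{\eta>0}\subset\mathcal L(X,Y)$ is a family of perturbed operators with $\|A_\eta-A\|\le\eta$. $A$, $y$, $x^\dagger$, $\alpha_{\max}$ and $D$ are fixed (independent of $\delta,\eta$). ''As $\delta,\eta\to0$'' means the joint limit $(\delta,\eta)\to(0,0)$. Tikhonov regularised solution: $x_{\alpha,\delta,\eta}=(A_\eta^*A_\eta+\alpha I)^{-1}A_\eta^*y_\delta$ for $\alpha>0$. Heuristic functionals, for $\alpha>0$, $T\in\mathcal L(X,Y)$, $z\in Y$: $\psi_{HD}(\alpha,T,z)=\|\sqrt\alpha\,(TT^*+\alpha I)^{-1}z\|$ (heuristic discrepancy), $\psi_{HR}(\alpha,T,z)=\|\alpha\,(TT^*+\alpha I)^{-3/2}z\|$ (Hanke-Raus), $\psi_{QO}(\alpha,T,z)=\|\alpha\,(T^*T+\alpha I)^{-2}T^*z\|$ (quasioptimality). Semi-heuristic functionals: (SH1) $\bar\psi(\alpha,A_\eta,y_\delta)=\psi(\alpha,A_\eta,y_\delta)-D\,\eta\,\|x_{\alpha,\delta,\eta}\|$; (SH2) $\bar\psi(\alpha,A_\eta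,y_\delta)=\psi(\alpha,A_\eta,y_\delta)-D\,\eta/\sqrt\alpha$.
   Formalization: The formal theorem additionally assumes that γ(η)→0 as η→0; without it the claim fails (e.g. γ≡α_max, A_η=A, y_δ=y≠0), and under the other hypotheses the conclusion itself forces γ(η)→0. *)

(* Defs.v *)
From HB Require Import structures.
From mathcomp Require Import all_boot all_order all_algebra.
From mathcomp Require Import complex.
From mathcomp Require Import boolp classical_sets functions reals topology.
From mathcomp Require Import normedtype.

Set Implicit Arguments.
Unset Strict Implicit.
Unset Printing Implicit Defensive.

Import Order.TTheory GRing.Theory Num.Theory.
Import numFieldNormedType.Exports.

Local Open Scope classical_set_scope.
Local Open Scope ring_scope.

(* Hilbert spaces are taken over the real or over the complex numbers; both
   scalar fields are treated at once. *)
Variant scalars := RealScalars | ComplexScalars.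

Definition scalar_field (R : realType) (F : scalars) : numFieldType :=
  match F with
  | RealScalars => R
  | ComplexScalars => R[i]
  end.

Definition conj_scalar (R : realType) (F : scalars) :
    scalar_field R F -> scalar_field R F :=
  match F with
  | RealScalars => fun a => a
  | ComplexScalars => fun a => (a^* )%R
  end.

Definition of_real (R : realType) (F : scalars) : R -> scalar_field R F :=
  match F with
  | RealScalars => fun a => a
  | ComplexScalars => fun a => (a%:C)%C
  end.

Definition real_part (R : realType) (F : scalars) : scalar_field R F -> R :=
  match F with
  | RealScalars => fun a => a
  | ComplexScalars => fun a => complex.Re a
  end.

(* The inner product is linear in its first argument. *)
HB.mixin Record isHilbert (R : realType) (F : scalars) X
    of CompleteNormedModule (scalar_field R F) X := {
  inner : {dot X for @conj_scalar R F};
  sqr_norm_inner : forall x : X, `|x| ^+ 2 = inner x x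
}.

#[short(type="hilbertType")]
HB.structure Definition Hilbert (R : realType) (F : scalars) :=
  {X of CompleteNormedModule (scalar_field R F) X & isHilbert R F X}.

(* The library norm of [X] takes its values in the scalar field. *)
Definition rnorm (R : realType) (F : scalars) (X : hilbertType R F) (x : X) : R :=
  real_part `|x|.

Section Operators.
Variables (R : realType) (F : scalars).
Implicit Types X Y : hilbertType R F.

Definition opnorm X Y (T : X -> Y) : R :=
  sup [set rnorm (T x) | x in [set x : X | rnorm x <= 1]].

(* The Hilbert space adjoint; [adjoint T y] is the unique [z] with
   <T x, y> = <x, z> for all [x] when [T] is linear and continuous. *)
Definition adjoint X Y (T : X -> Y) (y : Y) : X :=
  xget 0 [set z : X | forall x : X, inner (T x) y = inner x z].

(* Inverse of the function [P]; meant for bijective [P]. *)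
Definition inv_op X (P : X -> X) : X -> X := 'pinv_(fun=> 0) setT P.

Definition shift_op X (P : X -> X) (a : R) (x : X) : X := P x + of_real F a *: x.

Definition is_positive_sqrt X (P S : X -> X) : Prop :=
  [/\ linear S,
      continuous S,
      forall x y : X, inner (S x) y = inner x (S y),
      forall x : X, 0 <= inner (S x) x
    & forall x : X, S (S x) = P x].

(* The positive square root of a positive bounded operator exists and is
   unique, so the choice made here is immaterial for such [P]. *)
Definition sqrt_op X (P : X -> X) : X -> X :=
  xget (fun=> 0) [set S : X -> X | is_positive_sqrt P S].

(* P^(-2) and P^(-3/2) = (P^(1/2))^(-3) *)
Definition pow_m2 X (P : X -> X) : X -> X := iter 2 (inv_op P).
Definition pow_m3half X (P : X -> X) : X -> X := iter 3 (inv_op (sqrt_op P)).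

Definition tikhonov X Y (a : R) (T : X -> Y) (z : Y) : X :=
  inv_op (shift_op (adjoint T \o T) a) (adjoint T z).

Definition psi_HD X Y (a : R) (T : X -> Y) (z : Y) : R :=
  rnorm (of_real F (Num.sqrt a) *: inv_op (shift_op (T \o adjoint T) a) z).

Definition psi_HR X Y (a : R) (T : X -> Y) (z : Y) : R :=
  rnorm (of_real F a *: pow_m3half (shift_op (T \o adjoint T) a) z).

Definition psi_QO X Y (a : R) (T : X -> Y) (z : Y) : R :=
  rnorm (of_real F a *: pow_m2 (shift_op (adjoint T \o T) a) (adjoint T z)).

Definition least_squares_solution X Y (T : X -> Y) (y : Y) : set X :=
  [set x | forall x', rnorm (T x - y) <= rnorm (T x' - y)].

Definition min_norm_least_squares X Y (T : X -> Y) (y : Y) : set X :=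
  [set x | least_squares_solution T y x /\
     forall x', least_squares_solution T y x' -> rnorm x <= rnorm x'].

End Operators.

Variant heuristic := HD | HR | QO.

Variant semiheuristic := SH1 | SH2.

Section Functionals.
Variables (R : realType) (F : scalars) (X Y : hilbertType R F).

Definition psi (h : heuristic) : R -> (X -> Y) -> Y -> R :=
  match h with
  | HD => @psi_HD R F X Y
  | HR => @psi_HR R F X Y
  | QO => @psi_QO R F X Y
  end.

Definition psi_bar (h : heuristic) (s : semiheuristic) (D eta a : R)
    (T : X -> Y) (z : Y) : R :=
  match s with
  | SH1 => psi h a T z - D * eta * rnorm (tikhonov a T z)
  | SH2 => psi h a T z - D * eta / Num.sqrt a
  end.

End Functionals.

Definition argmin (R : realType) (S : set R) (f : R -> R) : set R :=
  [set a | S a /\ forall b, S b -> f a <= f b].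

(* Main.v *)
(* Write P = T T^* + a for T = A_eta, and x_T(z) for the Tikhonov solution.

   Every heuristic functional psi(a, T, .) is a seminorm that is at most
   |z| / sqrt a on all of Y, at most 2 |v| at z = T v and O(sqrt a |w|) at
   z = T T^* w.  Since A is injective, xdag is approximated by elements A^* w, so
   psi(a, T, A xdag) and the bias x_T(T xdag) - xdag tend to 0 when a, eta and
   eta / sqrt a do.  Comparing alpha_star with the competitor
   max(gamma(eta), delta) yields psi(alpha_star, T, y_delta) -> 0, because both
   penalties are O(eta / sqrt gamma); as psi is bounded below by a multiple of
   a sqrt a (times the norm of the data), this forces alpha_star -> 0.

   The remaining term x_T(y_delta - y) is compared with x_A(y_delta - y), to which
   the noise condition applies, and psi(a, A, y_delta - y) is brought back to
   psi(a, T, y_delta - y).  Both exchanges of A and T act on the noise only and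
   cost O(eta / a) delta, which is O(delta) by (iv). *)

From HB Require Import structures.
Require Import Defs.
From mathcomp Require Import all_boot all_order all_algebra.
From mathcomp Require Import complex.
From mathcomp Require Import boolp classical_sets functions reals topology.
From mathcomp Require Import normedtype sequences.
From mathcomp Require Import ring lra.

Set Implicit Arguments.
Unset Strict Implicit.
Unset Printing Implicit Defensive.

Import Order.TTheory GRing.Theory Num.Theory.
Import numFieldNormedType.Exports.

Local Open Scope classical_set_scope.
Local Open Scope ring_scope.

Lemma invS_lt_eps (R : realType) (e : R) : 0 < e ->
  exists N, forall n, (N <= n)%N -> n.+1%:R^-1 < e.
Proof.
move=> e0; have [N] := ltr_add_invr e0; rewrite add0r => hN; exists N => n Nn.
by apply: le_lt_trans hN; rewrite lef_pV2 ?posrE// ler_nat.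
Qed.

(** * Scalar fields: embedding of the reals and real parts *)

Section RealStructure.
Variables (R : realType) (F : scalars).
Implicit Types (a b : R) (c z w : scalar_field R F).
Local Notation ofr := (@of_real R F).
Local Notation Rp := (@real_part R F).

Lemma of_realD a b : ofr (a + b) = ofr a + ofr b.
Proof. by case: F => //=; rewrite rmorphD. Qed.

Lemma of_realN a : ofr (- a) = - ofr a.
Proof. by case: F => //=; rewrite rmorphN. Qed.

Lemma of_realM a b : ofr (a * b) = ofr a * ofr b.
Proof. by case: F => //=; rewrite rmorphM. Qed.

Lemma of_real1 : ofr 1 = 1.
Proof. by case: F. Qed.

Lemma of_real_nat n : ofr n%:R = n%:R.
Proof. by case: F => //=; rewrite rmorph_nat. Qed.

Lemma of_real0 : ofr 0 = 0.
Proof. by case: F. Qed.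

Lemma of_realK : cancel ofr Rp.
Proof. by case: F. Qed.

Lemma real_partD z w : Rp (z + w) = Rp z + Rp w.
Proof. by case: F z w => //= -[? ?] [? ?]. Qed.

Lemma real_partN z : Rp (- z) = - Rp z.
Proof. by case: F z => //= -[? ?]. Qed.

Lemma real_partZ a z : Rp (ofr a * z) = a * Rp z.
Proof. by case: F z => //= -[? ?]; rewrite /= mul0r subr0. Qed.

Lemma real_part_conj z : Rp (conj_scalar z) = Rp z.
Proof. by case: F z => //= -[? ?]. Qed.

Lemma of_real_part z : 0 <= z -> ofr (Rp z) = z.
Proof. by case: F z => //= -[x y]; rewrite lecE /= => /andP[/eqP-> _]. Qed.

Lemma ltr_of_real a b : (ofr a < ofr b) = (a < b).
Proof. by case: F => //=; rewrite ltcR. Qed.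

Lemma ler_of_real a b : (ofr a <= ofr b) = (a <= b).
Proof. by case: F => //=; rewrite lecR. Qed.

(** The choices [c = 1] and [c = 'i] read off both components. This lifts identities between real
    parts of inner products to scalar-valued identities. *)
Lemma real_part_ext z w :
  (forall c, Rp (c * z) = Rp (c * w)) -> z = w.
Proof.
case: F z w => [z w /(_ 1)|[x y] [x' y'] h]; first by rewrite /= !mul1r.
have:= h 1; have := h ('i)%C; rewrite /= !mul1r !mul0r !add0r !subr0.
by move=> /oppr_inj-> ->.
Qed.

End RealStructure.

(** * Real geometry of Hilbert spaces *)

Section Hilbert.
Variables (R : realType) (F : scalars).
Implicit Types X Y : hilbertType R F.
Local Notation ofr := (@of_real R F).

(* All estimates use only the underlying real Hilbert space structure. *)
Definition rinner X (x y : X) : R := real_part (inner x y).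

Section OneSpace.
Variable X : hilbertType R F.
Implicit Types (x y : X) (a : R).

Lemma rinnerDl x x' y : rinner (x + x') y = rinner x y + rinner x' y.
Proof. by rewrite /rinner linearDl real_partD. Qed.

Lemma rinnerNl x y : rinner (- x) y = - rinner x y.
Proof. by rewrite /rinner linearNl real_partN. Qed.

Lemma rinnerBl x x' y : rinner (x - x') y = rinner x y - rinner x' y.
Proof. by rewrite rinnerDl rinnerNl. Qed.

Lemma rinnerZl a x y : rinner (ofr a *: x) y = a * rinner x y.
Proof. by rewrite /rinner linearZl_LR real_partZ. Qed.

Lemma inner_conj x y : inner x y = conj_scalar (inner y x).
Proof. by rewrite hermitian_subproof expr0 mul1r. Qed.

Lemma rinnerC x y : rinner x y = rinner y x.
Proof. by rewrite /rinner inner_conj real_part_conj. Qed.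

Lemma rnormE x : `|x| = ofr (rnorm x).
Proof. by rewrite /rnorm of_real_part. Qed.

Lemma rnorm_sqr x : rnorm x ^+ 2 = rinner x x.
Proof. by rewrite /rinner -sqr_norm_inner rnormE [in RHS]expr2 -of_realM of_realK. Qed.

Lemma rnorm_ge0 x : 0 <= rnorm x.
Proof. by rewrite -(ler_of_real F) of_real0 -rnormE. Qed.

Lemma ler_rnormD x y : rnorm (x + y) <= rnorm x + rnorm y.
Proof. by rewrite -(ler_of_real F) of_realD -!rnormE ler_normD. Qed.

Lemma rnormN x : rnorm (- x) = rnorm x.
Proof. by rewrite /rnorm normrN. Qed.

Lemma rnorm0_eq0 x : rnorm x = 0 -> x = 0.
Proof. by move=> h; apply/eqP; rewrite -normr_eq0 rnormE h of_real0. Qed.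

Lemma rnormZ a x : rnorm (ofr a *: x) = `|a| * rnorm x.
Proof.
apply: (@pexpIrn _ 2); rewrite // ?nnegrE ?rnorm_ge0 ?mulr_ge0 ?rnorm_ge0//.
by rewrite exprMn !rnorm_sqr rinnerZl rinnerC rinnerZl mulrA -expr2 real_normK ?num_real.
Qed.

Lemma rinnerDr x y y' : rinner x (y + y') = rinner x y + rinner x y'.
Proof. by rewrite rinnerC rinnerDl !(rinnerC x). Qed.

Lemma rinnerNr x y : rinner x (- y) = - rinner x y.
Proof. by rewrite rinnerC rinnerNl rinnerC. Qed.

Lemma rinnerBr x y y' : rinner x (y - y') = rinner x y - rinner x y'.
Proof. by rewrite rinnerDr rinnerNr. Qed.

Lemma rinnerZr a x y : rinner x (ofr a *: y) = a * rinner x y.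
Proof. by rewrite rinnerC rinnerZl rinnerC. Qed.

Lemma rnorm0 : rnorm (0 : X) = 0.
Proof. by rewrite /rnorm normr0 -[0]/(0 : scalar_field R F) -(of_real0 R F) of_realK. Qed.

Lemma rnormC x y : rnorm (x - y) = rnorm (y - x).
Proof. by rewrite -rnormN opprB. Qed.

Lemma ler_rdistD z x y : rnorm (x - y) <= rnorm (x - z) + rnorm (z - y).
Proof. by rewrite -[x - y](subrKA z) ler_rnormD. Qed.

Lemma rnormD_sqr x y :
  rnorm (x + y) ^+ 2 = rnorm x ^+ 2 + 2 * rinner x y + rnorm y ^+ 2.
Proof. by rewrite !rnorm_sqr rinnerDl !rinnerDr (rinnerC y x); ring. Qed.

Lemma rnormB_sqr x y :
  rnorm (x - y) ^+ 2 = rnorm x ^+ 2 - 2 * rinner x y + rnorm y ^+ 2.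
Proof. by rewrite rnormD_sqr rinnerNr rnormN; ring. Qed.

(** Cauchy-Schwarz, from the nonnegative squared distance of [y] to its projection on the line of
    [x]. *)
Lemma rinner_le x y : rinner x y <= rnorm x * rnorm y.
Proof.
have [x0|x0] := eqVneq (rnorm x) 0.
  by rewrite (rnorm0_eq0 x0) rnorm0 mul0r -(scale0r 0) -(of_real0 R F) rinnerZl mul0r.
have := rnormB_sqr (ofr (rinner x y / rnorm x ^+ 2) *: x) y.
rewrite rnormZ exprMn real_normK ?num_real// rinnerZl => h.
have x_gt0 : 0 < rnorm x by rewrite lt_def x0 rnorm_ge0.
have y_ge0 := rnorm_ge0 y.
set t := rinner x y in h *; set a := rnorm x in h x_gt0 x0 *.
have := sqr_ge0 (rnorm (ofr (t / a ^+ 2) *: x - y)); rewrite h => {}h.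
have : t ^+ 2 <= (a * rnorm y) ^+ 2.
  rewrite -subr_ge0 (_ : _ - _ = a ^+ 2 *
    ((t / a ^+ 2) ^+ 2 * a ^+ 2 - 2 * (t / a ^+ 2 * t) + rnorm y ^+ 2)).
    by rewrite mulr_ge0 ?sqr_ge0.
  by field.
rewrite -[X in _ <= X -> _]real_normK ?num_real// -[X in X <= _ -> _]real_normK ?num_real//.
rewrite ler_pXn2r ?nnegrE// => /(le_trans (ler_norm _)).
by rewrite ger0_norm // mulr_ge0 // ltW.
Qed.

Lemma rinner_abs_le x y : `|rinner x y| <= rnorm x * rnorm y.
Proof. by rewrite ler_norml rinner_le andbT lerNl -rinnerNl -(rnormN x) rinner_le. Qed.

Lemma inner_ext x x' : (forall y, inner x y = inner x' y) -> x = x'.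
Proof.
move=> h; apply/eqP; rewrite -subr_eq0; apply/eqP/rnorm0_eq0.
apply/eqP; rewrite -sqrf_eq0 rnorm_sqr /rinner.
by rewrite linearBl /= h subrr; case: F.
Qed.

Lemma hilbert_cauchy (u : nat -> X) :
  (forall e, 0 < e -> exists N, forall m n, (N <= m)%N -> (N <= n)%N ->
     rnorm (u m - u n) < e) ->
  exists l, forall e, 0 < e -> exists N, forall n, (N <= n)%N ->
     rnorm (l - u n) < e.
Proof.
move=> cu.
have real_gt0 (e : scalar_field R F) : 0 < e -> 0 < real_part e.
  by move=> e0; rewrite -(ltr_of_real F) of_real0 of_real_part // ltW.
have : cvg (u @ \oo).
  apply/cauchy_cvgP/cauchyP => e e0.
  have [N hN] := cu _ (real_gt0 _ e0).
  exists (u N); exists N => // n /= Nn.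
  rewrite -ball_normE /ball_ /= rnormE -[ltRHS]of_real_part ?ltW//.
  by rewrite ltr_of_real hN.
move=> /cvg_ex[l /cvgrPdist_lt hl]; exists l => e e0.
have /hl[N _ hN] : 0 < ofr e by rewrite -(of_real0 R F) ltr_of_real.
by exists N => n /hN /=; rewrite rnormE ltr_of_real.
Qed.

End OneSpace.

Lemma linear_rnorm_bound X Y (T : {linear X -> Y}) : continuous T ->
  exists2 L, 0 <= L & forall x, rnorm (T x) <= L * rnorm x.
Proof.
move=> /(_ 0) cT; have /linear_boundedP [M [Mr hM]] := continuous_linear_bounded 0 cT.
(* The bound is available for every constant strictly above [M]. The maximum with 0 makes the chosen
   one nonnegative and the added 1 makes it strictly larger. *)
have M1 : M < ofr (Num.max 0 (real_part M) + 1).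
  case: F M Mr {hM} => [M _|M Mr] /=.
    by rewrite ltr_pwDr // le_max lexx orbT.
  rewrite -[X in X < _](@RRe_real _ M) ?ltcR ?ltr_pwDr// ?le_max ?lexx ?orbT//.
exists (Num.max 0 (real_part M) + 1).
  by rewrite addr_ge0 // le_max lexx.
by move=> x; have := hM _ M1 x; rewrite !rnormE -of_realM ler_of_real.
Qed.

Lemma rnorm_bound_continuous X Y (T : {linear X -> Y}) (L : R) :
  (forall x, rnorm (T x) <= L * rnorm x) -> continuous T.
Proof.
move=> hT; apply: bounded_linear_continuous; apply/linear_boundedP.
exists (ofr L); split; first by case: F => //=; rewrite ?num_real ?complex_real.
move=> c Lc x; apply: (@le_trans _ _ (ofr L * `|x|)); last by rewrite ler_wpM2r // ltW.
by rewrite !rnormE -of_realM ler_of_real.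
Qed.

(** * Orthogonal projection and Riesz representation *)

(** [V] is not assumed closed, so the limit [p] of a sequence minimizing the distance to [x] lies
    only in its closure. Orthogonality is the first-order condition at the minimum. *)
Lemma orthogonal_projection X (V : set X) (x : X) : V 0 ->
  (forall u v, V u -> V v -> V (u + v)) ->
  (forall a v, V v -> V (ofr a *: v)) ->
  exists p, (forall e, 0 < e -> exists2 v, V v & rnorm (p - v) < e) /\
    forall v, V v -> rinner (x - p) v = 0.
Proof.
move=> V0 VD VZ.
pose E := [set rnorm (x - v) ^+ 2 | v in V].
pose d := inf E.
have E_lb : has_lbound E by exists 0 => _ [v _ <-]; rewrite sqr_ge0.
have d_le v : V v -> d <= rnorm (x - v) ^+ 2 by move=> Vv; apply: ge_inf => //; exists v.
have ex_v (n : nat) : exists v, V v /\ rnorm (x - v) ^+ 2 < d + n.+1%:R^-1.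
  have [| |_ [v Vv <-] hv] := @inf_adherent _ E n.+1%:R^-1; first by rewrite invr_gt0.
    by split=> //; exists (rnorm (x - 0) ^+ 2), 0.
  by exists v.
have [v hv] := choice ex_v.
have Vv n : V (v n) by case: (hv n).
have ltv n : rnorm (x - v n) ^+ 2 < d + n.+1%:R^-1 by case: (hv n).
have [|p hp] := @hilbert_cauchy _ v.
  move=> e e0.
  have [|N hN] := @invS_lt_eps R (e ^+ 2 / 4); first by rewrite divr_gt0 // exprn_gt0.
  exists N => m n Nm Nn.
  (* parallelogram law for a minimizing sequence *)
  have dw := d_le _ (VZ 2^-1 _ (VD _ _ (Vv m) (Vv n))).
  have := rnormD_sqr (x - v m) (x - v n); have := rnormB_sqr (x - v m) (x - v n).
  have -> : x - v m + (x - v n) = ofr 2 *: (x - ofr 2^-1 *: (v m + v n)).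
    rewrite scalerBr scalerA -of_realM (@divff R 2) ?pnatr_eq0// (of_real1 R F) scale1r.
    rewrite (of_real_nat R F 2) scaler_nat mulr2n.
    by rewrite opprD addrACA.
  rewrite rnormZ exprMn opprB [_ + (v n - x)]addrC subrKA.
  rewrite (@ger0_norm _ 2)// => h1 h2.
  suff : rnorm (v n - v m) ^+ 2 < e ^+ 2.
    by rewrite (rnormC (v m)) ltr_pXn2r ?nnegrE ?rnorm_ge0 // ltW.
  have := ltv m; have := ltv n; have := hN _ Nm; have := hN _ Nn.
  move: h1 h2 dw; rewrite (expr2 2).
  by move: n.+1%:R^-1 m.+1%:R^-1 => i j; lra.
exists p; split=> [e /hp[N /(_ _ (leqnn N))]|w Vw]; first by exists (v N).
set s := rinner (x - p) w.
(* Minimality of [d] is tested at [v n + t w], and [n] goes to infinity. *)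
have key t : 0 <= - 2 * t * s + t ^+ 2 * rnorm w ^+ 2.
  apply/ler_addgt0Pl => e e0; rewrite addrC -lerBlDr sub0r.
  pose K := 2 * `|t| * rnorm w + 1.
  have K_gt0 : 0 < K by rewrite ltr_wpDl // !mulr_ge0 ?rnorm_ge0.
  have [|N hN] := hp (e / 2 / K); first by rewrite !divr_gt0.
  have [|M hM] := @invS_lt_eps R (e / 2); first by rewrite divr_gt0.
  pose n := maxn N M.
  have hn := hN n (leq_maxl _ _).
  have hm := hM n (leq_maxr _ _).
  have := d_le _ (VD _ _ (Vv n) (VZ t _ Vw)).
  rewrite opprD addrA rnormB_sqr rnormZ exprMn real_normK ?num_real// rinnerZr => h1.
  have h2 := ltv n; move: n.+1%:R^-1 hm h2 => i hm h2.
  have h3 : `|2 * t * (rinner (x - v n) w - s)| <= e / 2.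
    rewrite -rinnerBl [x - v n - _]addrC opprB [_ + (x - v n)](subrKA x).
    rewrite !normrM (@ger0_norm _ 2)//.
    apply: (@le_trans _ _ (2 * `|t| * (rnorm (p - v n) * rnorm w))).
      by rewrite ler_wpM2l ?rinner_abs_le // mulr_ge0.
    rewrite mulrCA [leRHS](_ : _ = e / 2 / K * K); last by rewrite divfK // lt0r_neq0.
    by apply: ler_pM; rewrite ?mulr_ge0 ?rnorm_ge0 ?(ltW hn) // lerDl.
  move: h3; rewrite ler_norml => /andP[h3 h4].
  move: h1 h2 hm h3 h4; lra.
have w_ge0 : 0 <= rnorm w ^+ 2 by rewrite sqr_ge0.
(* The added 1 keeps the denominator nonzero. At this [t] the quadratic equals [- t ^+ 2 * (k + 2)],
   which forces [t = 0] and hence [s = 0]. *)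
have {key} := key (s / (rnorm w ^+ 2 + 1)).
set k := rnorm w ^+ 2 in w_ge0 *.
have k1 : k + 1 != 0 by rewrite lt0r_neq0 // ltr_wpDl.
have -> : - 2 * (s / (k + 1)) * s + (s / (k + 1)) ^+ 2 * k = - (s / (k + 1)) ^+ 2 * (k + 2).
  by field.
move=> h; apply/eqP; have : (s / (k + 1)) ^+ 2 <= 0.
  have : 0 < k + 2 by lra.
  by rewrite mulNr oppr_ge0 in h => k2; rewrite pmulr_lle0 in h.
move=> h2; have : (s / (k + 1)) ^+ 2 == 0 by rewrite eq_le h2 sqr_ge0.
by rewrite sqrf_eq0 mulf_eq0 invr_eq0 (negPf k1) orbF.
Qed.

Lemma riesz_representation X (f : X -> R) (L : R) :
  (forall x y, f (x + y) = f x + f y) -> (forall a x, f (ofr a *: x) = a * f x) ->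
  (forall x, `|f x| <= L * rnorm x) -> exists z, forall x, f x = rinner x z.
Proof.
move=> fD fZ fL.
have [f0|/existsNP[x0 /eqP fx0]] := pselect (forall x, f x = 0).
  by exists 0 => x; rewrite f0 rinnerC /rinner linear0l; case: F.
have fB x y : f (x - y) = f x - f y.
  by rewrite fD -[- y]scale1r scalerN -scaleNr -(of_real1 R F) -of_realN fZ mulN1r.
have [] := @orthogonal_projection X [set v | f v = 0] x0.
- by rewrite /= -(scale0r 0) -(of_real0 R F) fZ mul0r.
- by move=> u v /= fu fv; rewrite fD fu fv addr0.
- by move=> a v /= fv; rewrite fZ fv mulr0.
(* x0 minus its projection on the kernel of f spans the orthogonal of the kernel *)
move=> p [pV px]; set n := x0 - p.
(* The kernel is closed because [f] is bounded, and [p] is a limit of kernel elements. *)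
have fp : f p = 0.
  apply/eqP; rewrite -normr_le0; apply/ler_addgt0Pl => e e0; rewrite addr0.
  have L1 : 0 < `|L| + 1 by rewrite ltr_wpDl.
  have [|v /= fv hv] := pV (e / (`|L| + 1)); first by rewrite divr_gt0.
  rewrite -[f p]subr0 -fv -fB (le_trans (fL _))//.
  rewrite (le_trans (ler_wpM2r (rnorm_ge0 _) (ler_norm L)))//.
  rewrite -[leRHS](divfK (lt0r_neq0 L1)) mulrC.
  by apply: ler_pM; rewrite ?rnorm_ge0 ?(ltW hv) // lerDl.
have fn : f n = f x0 by rewrite /n fB fp subr0.
have n0 : rnorm n ^+ 2 != 0.
  rewrite sqrf_eq0; apply/eqP => /rnorm0_eq0 n0; move: fx0; rewrite -fn n0.
  by rewrite -(scale0r 0) -(of_real0 R F) fZ mul0r eqxx.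
exists (ofr (f n / rnorm n ^+ 2) *: n) => x.
(* Removing the multiple of [n] with the same value of [f] leaves a kernel element, which is
   orthogonal to [n]. *)
have := px (x - ofr (f x / f n) *: n); rewrite /= fB fZ divfK ?fn// subrr => /(_ erefl).
rewrite rinnerC rinnerBl rinnerZl -rnorm_sqr rinnerZr => /eqP; rewrite subr_eq0 => /eqP ->.
by rewrite ?fn; field; move: n0; rewrite sqrf_eq0 => ->; rewrite fx0.
Qed.

(** * Adjoints *)

(** A symmetric relation, so that each estimate can be reused with operator and adjoint exchanged;
    [adjoint_pair P P] is self-adjointness. *)
Definition adjoint_pair X Y (T : X -> Y) (S : Y -> X) :=
  forall x y, inner (T x) y = inner x (S y).

Section AdjointPair.
Variables (X Y : hilbertType R F) (T : X -> Y) (S : Y -> X).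
Hypothesis TS : adjoint_pair T S.

Lemma adjoint_pair_sym : adjoint_pair S T.
Proof. by move=> y x; rewrite inner_conj -TS -inner_conj. Qed.

Lemma rinner_adjoint x y : rinner (T x) y = rinner x (S y).
Proof. by rewrite /rinner TS. Qed.

(** Linearity comes for free: tested against any [y], both sides agree by linearity of the inner
    product. *)
Lemma adjoint_pair_linear : linear T.
Proof.
move=> a u v; apply: inner_ext => y.
by rewrite TS !linearDl /= !linearZl_LR /= !TS.
Qed.

Lemma adjoint_pairD u v : T (u + v) = T u + T v.
Proof. by have := adjoint_pair_linear 1 u v; rewrite !scale1r. Qed.

Lemma adjoint_pairZ a u : T (a *: u) = a *: T u.
Proof.
apply: inner_ext => y.
by rewrite TS !linearZl_LR /= TS.
Qed.

Lemma adjoint_pairN u : T (- u) = - T u.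
Proof. by rewrite -scaleN1r adjoint_pairZ scaleN1r. Qed.

Lemma adjoint_pairB u v : T (u - v) = T u - T v.
Proof. by rewrite adjoint_pairD adjoint_pairN. Qed.

Lemma adjoint_pair0 : T 0 = 0.
Proof. by rewrite -(scale0r 0) adjoint_pairZ scale0r. Qed.

Lemma adjoint_pair_bound L : 0 <= L -> (forall x, rnorm (T x) <= L * rnorm x) ->
  forall y, rnorm (S y) <= L * rnorm y.
Proof.
move=> L0 hT y; have [->|Sy0] := eqVneq (rnorm (S y)) 0.
  by rewrite mulr_ge0 ?rnorm_ge0.
have Sy_gt0 : 0 < rnorm (S y) by rewrite lt_def Sy0 rnorm_ge0.
rewrite -(ler_pM2l Sy_gt0) -expr2 rnorm_sqr -rinner_adjoint.
rewrite (le_trans (rinner_le _ _))// mulrA ler_wpM2r ?rnorm_ge0//.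
by rewrite [leRHS]mulrC.
Qed.

End AdjointPair.

Lemma adjoint_pair_sub X Y (T T' : X -> Y) (S S' : Y -> X) :
  adjoint_pair T S -> adjoint_pair T' S' ->
  adjoint_pair (fun x => T x - T' x) (fun y => S y - S' y).
Proof. by move=> TS TS' x y; rewrite linearBl linearBr /= TS TS'. Qed.

Lemma adjoint_pair_comp X Y (T : X -> Y) (S : Y -> X) :
  adjoint_pair T S -> adjoint_pair (T \o S) (T \o S).
Proof. by move=> TS x y; rewrite /= TS (adjoint_pair_sym TS). Qed.

Lemma conj_scalar_real a : conj_scalar (ofr a) = ofr a.
Proof. by case: F => //=; exact: conjc_real. Qed.

Lemma adjoint_pair_shift X (P : X -> X) a :
  adjoint_pair P P -> adjoint_pair (shift_op P a) (shift_op P a).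
Proof.
move=> PP x y; rewrite /shift_op linearDl linearDr /= PP linearZl_LR linearZr_LR /=.
by rewrite conj_scalar_real.
Qed.

(** Riesz is applied to the real part of the inner product; replacing [x] by [c *: x] then recovers
    the full identity through [real_part_ext]. *)
Lemma adjointP X Y (T : {linear X -> Y}) : continuous T ->
  adjoint_pair T (adjoint T).
Proof.
move=> /linear_rnorm_bound[L L0 TL] x y; move: x.
apply: (@xgetPex _ 0 [set z | forall x, inner (T x) y = inner x z]).
have [] := @riesz_representation _ (fun x => rinner (T x) y) (L * rnorm y).
- by move=> x x'; rewrite linearD rinnerDl.
- by move=> a x; rewrite linearZ rinnerZl.
- move=> x; rewrite (le_trans (rinner_abs_le _ _))// mulrAC.
  by rewrite ler_wpM2r ?rnorm_ge0.
move=> z hz; exists z => x /=; apply: real_part_ext => c.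
by have := hz (c *: x); rewrite /rinner linearZ /= !linearZl_LR.
Qed.

(** The a priori bound [L] makes the set under the supremum bounded above, so that [opnorm] is a
    genuine upper bound on the unit ball. *)
Lemma opnorm_bound X Y (T : X -> Y) (L eta : R) :
  (forall a x, T (ofr a *: x) = ofr a *: T x) ->
  (forall x, rnorm (T x) <= L * rnorm x) -> opnorm T <= eta ->
  forall x, rnorm (T x) <= eta * rnorm x.
Proof.
move=> TZ TL Teta x; have [x0|x0] := eqVneq (rnorm x) 0.
  by rewrite (le_trans (TL x))// x0 !mulr0.
have x_gt0 : 0 < rnorm x by rewrite lt_def x0 rnorm_ge0.
have L0 : 0 <= L by rewrite -(pmulr_lge0 _ x_gt0) (le_trans _ (TL x)) ?rnorm_ge0.
rewrite -ler_pdivrMr// mulrC -[X in X * _]ger0_norm ?invr_ge0 ?rnorm_ge0//.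
rewrite -rnormZ -TZ; apply: le_trans Teta; apply: ub_le_sup.
  exists L => _ [u /= u1 <-]; rewrite (le_trans (TL u))//.
  by rewrite -[leRHS]mulr1 ler_wpM2l.
exists (ofr (rnorm x)^-1 *: x) => //=.
by rewrite rnormZ ger0_norm ?invr_ge0 ?rnorm_ge0// mulVf.
Qed.

Lemma inv_opK X (P : X -> X) z : (exists x, P x = z) -> P (inv_op P z) = z.
Proof. by move=> [x <-]; apply: pinvK; rewrite inE; exists x. Qed.

Lemma rnorm_eps_eq0 X (x : X) : (forall e, 0 < e -> rnorm x <= e) -> x = 0.
Proof.
move=> h; apply: rnorm0_eq0; apply/eqP; rewrite eq_le rnorm_ge0 andbT.
by apply/ler_addgt0Pl => e /h; rewrite addr0.
Qed.

(** * Inverses and square roots of coercive operators *)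

Section Coercive.
Variables (X : hilbertType R F) (P : X -> X) (m M : R).
Hypothesis (PP : adjoint_pair P P) (m_gt0 : 0 < m).
Hypothesis P_bound : forall x, rnorm (P x) <= M * rnorm x.
Hypothesis P_coercive : forall x, m * rnorm x ^+ 2 <= rinner (P x) x.

Lemma coercive_lower x : m * rnorm x <= rnorm (P x).
Proof.
have [->|x0] := eqVneq (rnorm x) 0; first by rewrite mulr0 rnorm_ge0.
have x_gt0 : 0 < rnorm x by rewrite lt_def x0 rnorm_ge0.
by rewrite -(ler_pM2r x_gt0) -mulrA -expr2 (le_trans (P_coercive x))// rinner_le.
Qed.

Lemma coercive_inj : injective P.
Proof.
move=> x y Pxy; apply/eqP; rewrite -subr_eq0; apply/eqP/rnorm0_eq0/eqP.
have := coercive_lower (x - y); rewrite (adjoint_pairB PP) Pxy subrr rnorm0.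
by rewrite pmulr_rle0// eq_le rnorm_ge0 andbT.
Qed.

(** Lax-Milgram: once the range is dense, [coercive_lower] makes preimages of a convergent sequence
    Cauchy, and boundedness passes the equation to the limit. *)
Lemma coercive_surj z : exists x, P x = z.
Proof.
have [] := @orthogonal_projection X (range P) z.
- by exists 0 => //; rewrite (adjoint_pair0 PP).
- by move=> _ _ [x _ <-] [y _ <-]; exists (x + y) => //; rewrite (adjoint_pairD PP).
- by move=> a _ [x _ <-]; exists (ofr a *: x) => //; rewrite (adjoint_pairZ PP).
move=> p [hp orth].
(* z - p is orthogonal to P (z - p), so coercivity makes the range dense. *)
have pz : p = z.
  apply/esym/eqP; rewrite -subr_eq0; apply/eqP/rnorm0_eq0/eqP.
  have := P_coercive (z - p); rewrite rinnerC orth; last by exists (z - p).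
  by rewrite pmulr_rle0// => h; rewrite -sqrf_eq0 eq_le h sqr_ge0.
have ex_x (n : nat) : exists x, rnorm (z - P x) < n.+1%:R^-1.
  have [|_ [x _ <-] hx] := hp n.+1%:R^-1; first by rewrite invr_gt0.
  by exists x; rewrite -pz.
have [x hx] := choice ex_x.
have [|l hl] := @hilbert_cauchy _ x.
  move=> e e0; have [|N hN] := @invS_lt_eps R (m * e / 2).
    by rewrite divr_gt0 ?mulr_gt0.
  exists N => i j Ni Nj; rewrite -(ltr_pM2l m_gt0).
  apply: le_lt_trans (coercive_lower _) _; rewrite (adjoint_pairB PP).
  apply: le_lt_trans (ler_rdistD z _ _) _; rewrite rnormC.
  move: (hx i) (hx j) (hN i Ni) (hN j Nj).
  by move: i.+1%:R^-1 j.+1%:R^-1 => u v; lra.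
exists l; apply/eqP; rewrite -subr_eq0; apply/eqP/rnorm_eps_eq0 => e e0.
have M1 : 0 < `|M| + 1 by rewrite ltr_wpDl.
have [|N1 hN1] := hl (e / 2 / (`|M| + 1)); first by rewrite !divr_gt0.
have [|N2 hN2] := @invS_lt_eps R (e / 2); first by rewrite divr_gt0.
pose n := maxn N1 N2.
have {hN1} h1 := hN1 n (leq_maxl _ _); have {hN2} h2 := hN2 n (leq_maxr _ _).
apply: le_trans (ler_rdistD (P (x n)) _ _) _.
have h3 := hx n; rewrite rnormC in h3.
have h4 : rnorm (P l - P (x n)) <= e / 2.
  rewrite -(adjoint_pairB PP) (le_trans (P_bound _))//.
  rewrite (le_trans (ler_wpM2r (rnorm_ge0 _) (ler_norm M)))//.
  rewrite -[leRHS](divfK (lt0r_neq0 M1)) mulrC.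
  by apply: ler_pM; rewrite ?rnorm_ge0 ?(ltW h1) // lerDl.
by move: n.+1%:R^-1 h2 h3 => i; move: h4; lra.
Qed.

End Coercive.

Section SquareRoot.
Variables (X : hilbertType R F) (B : X -> X) (q : R).
Hypothesis (BB : adjoint_pair B B) (q_ge0 : 0 <= q) (q_lt1 : q < 1).
Hypothesis B_bound : forall x, rnorm (B x) <= q * rnorm x.

(* Iterates of Y |-> (B + Y^2) / 2, a contraction on the ball of radius q; at the
   fixed point (1 - Y)^2 = 1 - B. *)
Fixpoint sqrt_iter n (x : X) : X :=
  if n is n'.+1 then ofr 2^-1 *: (B x + sqrt_iter n' (sqrt_iter n' x)) else 0.

Lemma sqrt_iter_adjoint n : adjoint_pair (sqrt_iter n) (sqrt_iter n).
Proof.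
elim: n => [|n IH] x y /=; first by rewrite linear0l linear0r.
rewrite linearZl_LR linearZr_LR /= conj_scalar_real linearDl linearDr /=.
by rewrite BB !IH.
Qed.

Lemma sqrt_iter_bound n x : rnorm (sqrt_iter n x) <= q * rnorm x.
Proof.
elim: n x => [|n IH] x /=; first by rewrite rnorm0 mulr_ge0 ?rnorm_ge0.
rewrite rnormZ ger0_norm ?invr_ge0//.
have h1 := ler_rnormD (B x) (sqrt_iter n (sqrt_iter n x)).
have h2 : q * rnorm (sqrt_iter n x) <= 1 * (q * rnorm x).
  by apply: ler_pM => //; [exact: rnorm_ge0|exact: ltW].
by have := IH (sqrt_iter n x); have := B_bound x; move: h1 h2; lra.
Qed.

(** With Y_n for the iterates, Y_{n+1}^2 - Y_n^2 = Y_{n+1} (Y_{n+1} - Y_n) + (Y_{n+1} - Y_n) Y_n.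
    Each summand gains a factor [q], and the factor 1/2 compensates for there being two. *)
Lemma sqrt_iterS n x : rnorm (sqrt_iter n.+1 x - sqrt_iter n x) <= q ^+ n * rnorm x.
Proof.
elim: n x => [|n IH] x.
  rewrite subr0 expr0 (le_trans (sqrt_iter_bound 1 x))//.
  by rewrite ler_wpM2r ?rnorm_ge0 // ltW.
have -> : sqrt_iter n.+2 x - sqrt_iter n.+1 x =
    ofr 2^-1 *: (sqrt_iter n.+1 (sqrt_iter n.+1 x) - sqrt_iter n (sqrt_iter n x)).
  rewrite [sqrt_iter n.+2 x]/(ofr 2^-1 *: _) [in X in _ - X]/sqrt_iter -/sqrt_iter.
  by rewrite -scalerBr opprD addrACA subrr add0r.
rewrite rnormZ ger0_norm ?invr_ge0//.
have := ler_rdistD (sqrt_iter n.+1 (sqrt_iter n x))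
  (sqrt_iter n.+1 (sqrt_iter n.+1 x)) (sqrt_iter n (sqrt_iter n x)).
rewrite -(adjoint_pairB (sqrt_iter_adjoint n.+1)) => h1.
have h2 := sqrt_iter_bound n.+1 (sqrt_iter n.+1 x - sqrt_iter n x).
have h3 := ler_wpM2l q_ge0 (IH x).
have h4 := IH (sqrt_iter n x).
have h5 := ler_wpM2l (exprn_ge0 n q_ge0) (sqrt_iter_bound n x).
move: h1 h2 h3 h4 h5; rewrite exprS; lra.
Qed.

Lemma sqrt_iter_dist n k x :
  (1 - q) * rnorm (sqrt_iter (n + k) x - sqrt_iter n x) <= q ^+ n * rnorm x.
Proof.
(* The exact partial geometric sum is kept so that the induction on [k] closes. *)
suff : (1 - q) * rnorm (sqrt_iter (n + k) x - sqrt_iter n x) <=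
    (q ^+ n - q ^+ (n + k)) * rnorm x.
  move/le_trans; apply; rewrite ler_wpM2r ?rnorm_ge0//.
  by rewrite lerBlDr lerDl exprn_ge0.
elim: k => [|k IH]; first by rewrite addn0 !subrr rnorm0 mulr0 mul0r.
have := ler_rdistD (sqrt_iter (n + k) x) (sqrt_iter (n + k.+1) x) (sqrt_iter n x).
have q1 : 0 <= 1 - q by rewrite subr_ge0 ltW.
move/(ler_wpM2l q1); have := sqrt_iterS (n + k) x; rewrite -addnS.
move/(ler_wpM2l q1); move: IH; rewrite addnS exprS; lra.
Qed.

Lemma sqrt_iter_limit :
  exists Y : X -> X, forall x e, 0 < e ->
    exists N, forall n, (N <= n)%N -> rnorm (Y x - sqrt_iter n x) < e.
Proof.
have cvg_x x : exists l, forall e, 0 < e -> exists N, forall n, (N <= n)%N ->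
    rnorm (l - sqrt_iter n x) < e; last first.
  by have [Y hY] := choice cvg_x; exists Y.
apply: hilbert_cauchy => e e0.
have q1 : 0 < 1 - q by rewrite subr_gt0.
have x1 : 0 < rnorm x + 1 by rewrite ltr_wpDl ?rnorm_ge0.
have /cvgrPdist_lt cvgq : q ^+ n @[n --> \oo] --> (0 : R).
  by apply: cvg_expr; rewrite ger0_norm.
have [|N _ hN] := cvgq ((1 - q) * (e / 2) / (rnorm x + 1)).
  by rewrite divr_gt0 // mulr_gt0 // divr_gt0.
have dist n : (N <= n)%N -> rnorm (sqrt_iter n x - sqrt_iter N x) < e / 2.
  move=> Nn; rewrite -(ltr_pM2l q1) -(subnKC Nn).
  apply: le_lt_trans (sqrt_iter_dist _ _ _) _.
  have := hN N (leqnn N); rewrite /= sub0r normrN ger0_norm ?exprn_ge0//.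
  rewrite ltr_pdivlMr// => /(le_lt_trans _); apply.
  by rewrite ler_wpM2l ?exprn_ge0 // lerDl.
exists N => i j Ni Nj; have := dist i Ni; have := dist j Nj.
have := ler_rdistD (sqrt_iter N x) (sqrt_iter i x) (sqrt_iter j x).
by rewrite (rnormC (sqrt_iter N x)); lra.
Qed.

Lemma sqrt_fixpoint : exists Y : X -> X,
  [/\ adjoint_pair Y Y, forall x, rnorm (Y x) <= q * rnorm x &
      forall x, ofr 2 *: Y x = B x + Y (Y x)].
Proof.
have [Y hY] := sqrt_iter_limit.
(* The recursion links iterate [n.+1] to iterate [n], hence both indices at [x]; [y] will also be
   instantiated with [Y x]. *)
have near2 x y e : 0 < e -> exists n, [/\ rnorm (Y x - sqrt_iter n x) < e,
    rnorm (Y x - sqrt_iter n.+1 x) < e & rnorm (Y y - sqrt_iter n y) < e].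
  move=> e0; have [N1 h1] := hY x e e0; have [N2 h2] := hY y e e0.
  exists (maxn N1 N2); split; [apply: h1|apply: h1|apply: h2].
  - exact: leq_maxl.
  - by rewrite (leq_trans (leq_maxl _ _) (leqnSn _)).
  - exact: leq_maxr.
have Ybound x : rnorm (Y x) <= q * rnorm x.
  apply/ler_addgt0Pl => e /(near2 x x)[n [h _ _]].
  have := ler_rnormD (Y x - sqrt_iter n x) (sqrt_iter n x); rewrite subrK.
  by have := sqrt_iter_bound n x; move: h; lra.
exists Y; split => //.
- move=> x y; apply: real_part_ext => c.
  rewrite -[c * inner (Y x) y]linearZl_LR -[c * inner x (Y y)]linearZl_LR /=.
  apply/eqP; rewrite -[_ == _]/(rinner (c *: Y x) y == rinner (c *: x) (Y y)).
  rewrite -subr_eq0 -normr_le0; apply/ler_addgt0Pl => e e0; rewrite addr0.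
  pose K := real_part `|c| * rnorm y + rnorm (c *: x) + 1.
  have c0 : 0 <= real_part `|c| by rewrite -(ler_of_real F) of_real_part // of_real0.
  have K0 : 0 < K by rewrite ltr_wpDl // addr_ge0 ?mulr_ge0 ?rnorm_ge0.
  have [|n [h1 _ h2]] := near2 x y (e / K); first by rewrite divr_gt0.
  have -> : rinner (c *: Y x) y - rinner (c *: x) (Y y) =
    rinner (c *: (Y x - sqrt_iter n x)) y - rinner (c *: x) (Y y - sqrt_iter n y).
    rewrite scalerBr rinnerBl rinnerBr -(adjoint_pairZ (sqrt_iter_adjoint n)).
    by rewrite (rinner_adjoint (sqrt_iter_adjoint n)); ring.
  rewrite (le_trans (ler_normB _ _))//.
  have h3 := rinner_abs_le (c *: (Y x - sqrt_iter n x)) y.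
  have h4 := rinner_abs_le (c *: x) (Y y - sqrt_iter n y).
  have h5 : rnorm (c *: (Y x - sqrt_iter n x)) <= real_part `|c| * (e / K).
    rewrite -(ler_of_real F) -rnormE normrZ of_realM of_real_part//.
    by rewrite ler_wpM2l // rnormE ler_of_real ltW.
  have h6 := ler_wpM2r (rnorm_ge0 y) h5.
  have h7 := ler_wpM2l (rnorm_ge0 (c *: x)) (ltW h2).
  have : K * (e / K) = e by rewrite mulrC divfK // lt0r_neq0.
  have : 0 <= e / K by rewrite divr_ge0 ?ltW.
  move: h3 h4 h6 h7; rewrite /K; lra.
- move=> x; apply/eqP; rewrite -subr_eq0; apply/eqP/rnorm_eps_eq0 => e e0.
  have [|n [h1 h2 h3]] := near2 x (Y x) (e / 4); first by rewrite divr_gt0.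
  (* The recursion for [sqrt_iter n.+1 x] cancels [B x], leaving only differences between [Y] and
     its iterates. *)
  have -> : ofr 2 *: Y x - (B x + Y (Y x)) =
     ofr 2 *: (Y x - sqrt_iter n.+1 x) +
     (sqrt_iter n (sqrt_iter n x - Y x) - (Y (Y x) - sqrt_iter n (Y x))).
    rewrite scalerBr /= scalerA -of_realM mulfV ?pnatr_eq0// (of_real1 R F) scale1r.
    rewrite (adjoint_pairB (sqrt_iter_adjoint n)).
    set a := ofr 2 *: Y x; set b := Y (Y x); set c := sqrt_iter n (Y x).
    set d := sqrt_iter n (sqrt_iter n x); set f := B x.
    by rewrite opprB (addrA (d - c)) subrK !opprD -addrA [- f - d + _]addrA subrK.
  have := ler_rnormD (ofr 2 *: (Y x - sqrt_iter n.+1 x))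
     (sqrt_iter n (sqrt_iter n x - Y x) - (Y (Y x) - sqrt_iter n (Y x))).
  have := ler_rnormD (sqrt_iter n (sqrt_iter n x - Y x)) (- (Y (Y x) - sqrt_iter n (Y x))).
  have := sqrt_iter_bound n (sqrt_iter n x - Y x).
  have := ler_wpM2r (rnorm_ge0 (sqrt_iter n x - Y x)) (ltW q_lt1).
  rewrite rnormZ rnormN (@ger0_norm _ 2)// (rnormC (sqrt_iter n x)).
  move: h1 h2 h3; lra.
Qed.

End SquareRoot.

(** In the order of [R[i]] nonnegativity includes a vanishing imaginary part, which invariance under
    conjugation provides. *)
Lemma scalar_ge0 (z : scalar_field R F) :
  z = conj_scalar z -> 0 <= real_part z -> 0 <= z.
Proof.
case: F z => //= -[x y] [] /eqP; rewrite -addr_eq0 -mulr2n mulrn_eq0 /= => /eqP -> x0.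
by rewrite lecE /= eqxx.
Qed.

Section PositiveSqrt.
Variables (X : hilbertType R F) (P : X -> X) (m M : R).
Hypothesis (PP : adjoint_pair P P) (m_gt0 : 0 < m) (mM : m <= M).
Hypothesis P_bound : forall x, rnorm (P x) <= M * rnorm x.
Hypothesis P_coercive : forall x, m * rnorm x ^+ 2 <= rinner (P x) x.

Lemma positive_sqrt_exists : exists S : X -> X, is_positive_sqrt P S.
Proof.
have M_gt0 : 0 < M by rewrite (lt_le_trans m_gt0).
pose k := M ^+ 2 / m.
have k_gt0 : 0 < k by rewrite divr_gt0 ?exprn_gt0.
(* k is large enough for B = 1 - P / k to have norm at most q < 1. *)
pose B x := x - ofr k^-1 *: P x.
(* Expanding the square gives |B x|^2 <= (1 - 2 m / k + M^2 / k^2) |x|^2, and M^2 / k^2 = m / k by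
   the choice of [k]. *)
pose q := Num.sqrt (1 - m / k).
have mk : m / k <= 1.
  rewrite ler_pdivrMr// mul1r /k ler_pdivlMr// -expr2.
  by rewrite ler_pXn2r ?nnegrE // ltW.
have mk0 : 0 < m / k by rewrite divr_gt0.
have BB : adjoint_pair B B.
  move=> x y; rewrite /B linearBl linearBr /= linearZl_LR linearZr_LR /=.
  by rewrite conj_scalar_real PP.
have q0 : 0 <= q by rewrite sqrtr_ge0.
have q2 : q ^+ 2 = 1 - m / k by rewrite sqr_sqrtr // subr_ge0.
have q1 : q < 1.
  by rewrite -(@ltr_pXn2r _ 2)// ?nnegrE// q2 expr1n ltrBlDr ltrDl.
have B_bound x : rnorm (B x) <= q * rnorm x.
  rewrite -(@ler_pXn2r _ 2)// ?nnegrE ?mulr_ge0 ?rnorm_ge0//.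
  rewrite exprMn q2 /B rnormB_sqr rnormZ exprMn real_normK ?num_real//.
  rewrite rinnerZr rinnerC.
  have h1 : rnorm (P x) ^+ 2 <= M ^+ 2 * rnorm x ^+ 2.
    by rewrite -exprMn ler_pXn2r ?nnegrE ?mulr_ge0 ?rnorm_ge0 // ltW.
  have k20 : 0 <= k^-1 ^+ 2 by rewrite exprn_ge0 // invr_ge0 ltW.
  have := ler_wpM2l k20 h1.
  have -> : k^-1 ^+ 2 * (M ^+ 2 * rnorm x ^+ 2) = m / k * rnorm x ^+ 2.
    by rewrite /k; field; rewrite !lt0r_neq0.
  have k0 : 0 <= k^-1 by rewrite invr_ge0 ltW.
  have := ler_wpM2l k0 (P_coercive x).
  lra.
have [Y [YY Yb Yeq]] := sqrt_fixpoint BB q0 q1 B_bound.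
(* The fixed-point equation gives (1 - Y)^2 = 1 - B = P / k. *)
pose S x := ofr (Num.sqrt k) *: (x - Y x).
have SS : adjoint_pair S S.
  move=> x y; rewrite /S linearZl_LR linearZr_LR /= linearBl linearBr /=.
  by rewrite conj_scalar_real YY.
have S_pos x : 0 <= rinner (S x) x.
  rewrite /S rinnerZl mulr_ge0 ?sqrtr_ge0// rinnerBl -rnorm_sqr subr_ge0.
  rewrite (le_trans (rinner_le _ _))//.
  rewrite expr2 ler_wpM2r ?rnorm_ge0// (le_trans (Yb x))//.
  by rewrite -[leRHS]mul1r ler_wpM2r ?rnorm_ge0 // ltW.
have S_lin := adjoint_pair_linear SS.
exists S; split => //.
- pose Sl : {linear X -> X} := HB.pack S (GRing.isLinear.Build _ _ _ _ S S_lin).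
  have : continuous Sl; last by [].
  apply: (@rnorm_bound_continuous _ _ _ (Num.sqrt k * 2)) => x /=.
  rewrite /S rnormZ ger0_norm ?sqrtr_ge0// -mulrA ler_wpM2l ?sqrtr_ge0//.
  rewrite (le_trans (ler_rnormD _ _))// rnormN.
  have := Yb x; have := ler_wpM2r (rnorm_ge0 x) (ltW q1); lra.
- by move=> x; apply: scalar_ge0 (S_pos x); rewrite -inner_conj.
- move=> x; rewrite /S (adjoint_pairZ YY) (adjoint_pairB YY).
  rewrite -scalerBr scalerA -of_realM -expr2 sqr_sqrtr ?ltW//.
  have -> : x - Y x - (Y x - Y (Y x)) = ofr k^-1 *: P x.
    have : Y (Y x) = ofr 2 *: Y x - B x by rewrite Yeq addrAC subrr add0r.
    move=> ->; rewrite /B (of_real_nat R F 2) scaler_nat mulr2n.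
    set y := Y x; set z := ofr _ *: _.
    have -> : y - (y + y - (x - z)) = x - z - y.
      by rewrite opprB opprD addrC addrA subrK.
    by rewrite opprB addrA subrK opprB addrCA subrr addr0.
  by rewrite scalerA -of_realM mulfV ?lt0r_neq0// (of_real1 R F) scale1r.
Qed.

Lemma sqrt_opP : is_positive_sqrt P (sqrt_op P).
Proof.
apply: (@xgetPex _ (fun=> 0) [set S : X -> X | is_positive_sqrt P S]).
exact: positive_sqrt_exists.
Qed.

End PositiveSqrt.

Section InverseAdjoint.
Variables (X : hilbertType R F) (P : X -> X).
Hypotheses (PP : adjoint_pair P P) (P_surj : forall z, exists x, P x = z).

Lemma inv_op_adjoint : adjoint_pair (inv_op P) (inv_op P).
Proof.
move=> x y; rewrite -{1}(inv_opK (P_surj y)) -PP.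
by rewrite (inv_opK (P_surj x)).
Qed.

End InverseAdjoint.

(** * The regularized inverse *)

Section ShiftInverse.
Variables (X Y : hilbertType R F) (T : X -> Y) (S : Y -> X) (a L : R).
Hypotheses (TS : adjoint_pair T S) (a_gt0 : 0 < a) (L_ge0 : 0 <= L).
Hypothesis T_bound : forall x, rnorm (T x) <= L * rnorm x.
Local Notation P := (shift_op (T \o S) a).
Local Notation Q := (shift_op (S \o T) a).

Let ST : adjoint_pair S T := adjoint_pair_sym TS.
Let sa_gt0 : 0 < Num.sqrt a. Proof. by rewrite sqrtr_gt0. Qed.
Let sa2 : Num.sqrt a ^+ 2 = a. Proof. by rewrite sqr_sqrtr // ltW. Qed.

Lemma shift_adjoint : adjoint_pair P P.
Proof. exact/adjoint_pair_shift/adjoint_pair_comp. Qed.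

Lemma shift_energy x : rinner (P x) x = a * rnorm x ^+ 2 + rnorm (S x) ^+ 2.
Proof.
by rewrite /shift_op /= rinnerDl rinnerZl (rinner_adjoint TS) -!rnorm_sqr addrC.
Qed.

Lemma shift_bound x : rnorm (P x) <= (L ^+ 2 + a) * rnorm x.
Proof.
rewrite /shift_op /= (le_trans (ler_rnormD _ _))// rnormZ (ger0_norm (ltW a_gt0)).
rewrite mulrDl lerD2r (le_trans (T_bound _))// expr2 -mulrA ler_wpM2l//.
exact: adjoint_pair_bound.
Qed.

Lemma shift_coercive x : a * rnorm x ^+ 2 <= rinner (P x) x.
Proof. by rewrite shift_energy lerDl sqr_ge0. Qed.

Lemma shift_inj : injective P.
Proof. exact: coercive_inj shift_adjoint a_gt0 shift_coercive. Qed.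

Lemma shift_surj z : exists x, P x = z.
Proof. exact: coercive_surj shift_adjoint a_gt0 shift_bound shift_coercive z. Qed.

Lemma shift_invK z : P (inv_op P z) = z.
Proof. exact/inv_opK/shift_surj. Qed.

Lemma shift_inv_adjoint : adjoint_pair (inv_op P) (inv_op P).
Proof. exact: inv_op_adjoint shift_adjoint shift_surj. Qed.

(** Pairing the equation with [x] turns the energy identity into a |x|^2 + |S x|^2 <= |f| |x| + |g|
    |S x|. The cases [f = 0] and [g = 0] bound the regularized inverse; the mixed case drives the
    perturbation estimates. *)
Lemma shift_estimate x f g : P x = f + T g ->
  a * rnorm x <= rnorm f + Num.sqrt a * rnorm g /\
  Num.sqrt a * rnorm (S x) <= rnorm f + Num.sqrt a * rnorm g.
Proof.
move=> Px; have := shift_energy x; rewrite Px rinnerDl (rinner_adjoint TS).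
have := rinner_le f x; have := rinner_le g (S x).
rewrite -[in RHS]sa2 -[in X in X * rnorm x <= _]sa2.
move: (Num.sqrt a) sa_gt0 => s s0.
have := rnorm_ge0 x; have := rnorm_ge0 (S x); have := rnorm_ge0 f; have := rnorm_ge0 g.
move: (rnorm x) (rnorm (S x)) (rnorm f) (rnorm g) (rinner f x) (rinner g (S x)).
move=> t r p q u v q0 p0 r0 t0 hv hu E.
have {}E : s ^+ 2 * t ^+ 2 + r ^+ 2 <= p * t + q * r by lra.
(* [w] stands for the larger of [s * t] and [r]; both right-hand terms are bounded through it and
   one factor [w] is divided out. *)
have key w : s * t <= w -> r <= w -> 0 <= w -> w ^+ 2 <= s ^+ 2 * t ^+ 2 + r ^+ 2 ->
    s * w <= p + s * q.
  move=> tw rw w0 hw; have [->|wn0] := eqVneq w 0.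
    by rewrite mulr0 addr_ge0 // mulr_ge0 // ltW.
  have w_gt0 : 0 < w by rewrite lt_def wn0.
  rewrite -(ler_pM2r w_gt0) -mulrA -expr2.
  have h1 := ler_wpM2l (ltW s0) (le_trans hw E).
  have h2 := ler_wpM2l p0 tw.
  have h3 := ler_wpM2l (mulr_ge0 (ltW s0) q0) rw.
  move: h1 h2 h3; lra.
have [str|/ltW rst] := leP (s * t) r.
  have h : s * r <= p + s * q.
    by apply: key => //; rewrite lerDr mulr_ge0 ?sqr_ge0.
  by split => //; apply: le_trans h; rewrite expr2 -mulrA ler_wpM2l // ltW.
have h : s * (s * t) <= p + s * q.
  apply: key => //; first by rewrite mulr_ge0 // ltW.
  by rewrite exprMn lerDl sqr_ge0.
by split; [rewrite expr2 -mulrA|apply: le_trans h; rewrite ler_wpM2l // ltW].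
Qed.

Lemma shift_inv_bound z : a * rnorm (inv_op P z) <= rnorm z.
Proof.
have [] := @shift_estimate (inv_op P z) z 0; last by rewrite rnorm0 mulr0 addr0.
by rewrite shift_invK (adjoint_pair0 TS) addr0.
Qed.

Lemma shift_inv_adjoint_bound z : Num.sqrt a * rnorm (S (inv_op P z)) <= rnorm z.
Proof.
have [] := @shift_estimate (inv_op P z) z 0; last by rewrite rnorm0 mulr0 addr0.
by rewrite shift_invK (adjoint_pair0 TS) addr0.
Qed.

Lemma shift_inv_range_bound v :
  Num.sqrt a * rnorm (inv_op P (T v)) <= rnorm v.
Proof.
have Px : P (inv_op P (T v)) = 0 + T v by rewrite shift_invK add0r.
have [+ _] := shift_estimate Px; rewrite rnorm0 add0r -{1}sa2 expr2 -mulrA.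
by rewrite ler_pM2l.
Qed.

Lemma shift_inv_range_bound2 v : rnorm (S (inv_op P (T v))) <= rnorm v.
Proof.
have Px : P (inv_op P (T v)) = 0 + T v by rewrite shift_invK add0r.
have [_] := shift_estimate Px; rewrite rnorm0 add0r.
by rewrite ler_pM2l.
Qed.

Lemma shift_inv_residual w : inv_op P (T (S w)) = w - ofr a *: inv_op P w.
Proof.
apply: shift_inj; rewrite shift_invK (adjoint_pairB shift_adjoint).
by rewrite (adjoint_pairZ shift_adjoint) shift_invK /shift_op /= addrK.
Qed.

Lemma shift_inv_lower z : rnorm z <= (L ^+ 2 + a) * rnorm (inv_op P z).
Proof. by rewrite -{1}(shift_invK z) shift_bound. Qed.

(** [W] is P^(-1/2). *)
Local Notation W := (inv_op (sqrt_op P)).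

Lemma sqrt_shiftP : is_positive_sqrt P (sqrt_op P).
Proof.
have hM : a <= L ^+ 2 + a by rewrite lerDr sqr_ge0.
exact: (sqrt_opP shift_adjoint a_gt0 hM shift_bound shift_coercive).
Qed.

Lemma sqrt_shift_surj z : exists x, sqrt_op P x = z.
Proof.
have [_ _ _ _ SS] := sqrt_shiftP; exists (sqrt_op P (inv_op P z)).
by rewrite SS shift_invK.
Qed.

Lemma sqrt_shift_inv_adjoint : adjoint_pair W W.
Proof. by have [_ _ SS _ _] := sqrt_shiftP; exact: inv_op_adjoint SS sqrt_shift_surj. Qed.

Lemma sqrt_shift_inv2 z : W (W z) = inv_op P z.
Proof.
have [_ _ _ _ SS] := sqrt_shiftP; apply: shift_inj.
by rewrite shift_invK -SS !(inv_opK (sqrt_shift_surj _)).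
Qed.

Lemma sqrt_shift_inv_sqr u : rnorm (W u) ^+ 2 = rinner (inv_op P u) u.
Proof.
by rewrite rnorm_sqr -(rinner_adjoint sqrt_shift_inv_adjoint) sqrt_shift_inv2.
Qed.

(** Both sides are the inner product of P^(-1) u with [u]. This removes the square root from all
    later estimates. *)
Lemma sqrt_shift_inv_energy u : rnorm (W u) ^+ 2 =
  a * rnorm (inv_op P u) ^+ 2 + rnorm (S (inv_op P u)) ^+ 2.
Proof. by rewrite sqrt_shift_inv_sqr -shift_energy shift_invK rinnerC. Qed.

Lemma sqrt_shift_inv_bound u : Num.sqrt a * rnorm (W u) <= rnorm u.
Proof.
rewrite -(@ler_pXn2r _ 2)// ?nnegrE ?mulr_ge0 ?rnorm_ge0 ?sqrtr_ge0//.
rewrite exprMn sa2 sqrt_shift_inv_sqr.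
have := rinner_le (inv_op P u) u; move/(ler_wpM2l (ltW a_gt0)).
have := ler_wpM2r (rnorm_ge0 u) (shift_inv_bound u); rewrite expr2; lra.
Qed.

Lemma sqrt_shift_inv_lower u :
  Num.sqrt a * rnorm u <= (L ^+ 2 + a) * rnorm (W u).
Proof.
have M0 : 0 <= L ^+ 2 + a by rewrite addr_ge0 ?sqr_ge0 // ltW.
rewrite -(@ler_pXn2r _ 2)// ?nnegrE ?mulr_ge0 ?rnorm_ge0 ?sqrtr_ge0//.
rewrite !exprMn sa2 sqrt_shift_inv_energy.
have h : rnorm u ^+ 2 <= (L ^+ 2 + a) ^+ 2 * rnorm (inv_op P u) ^+ 2.
  by rewrite -exprMn ler_pXn2r ?nnegrE ?mulr_ge0 ?rnorm_ge0 // shift_inv_lower.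
have := ler_wpM2l (ltW a_gt0) h.
have := mulr_ge0 (sqr_ge0 (L ^+ 2 + a)) (sqr_ge0 (rnorm (S (inv_op P u)))).
lra.
Qed.

End ShiftInverse.

(** * Perturbation of the regularized inverse and its square root *)

Section Perturbation.
Variables (X Y : hilbertType R F) (T T' : X -> Y) (S S' : Y -> X) (a L eta : R).
Hypotheses (TS : adjoint_pair T S) (TS' : adjoint_pair T' S').
Hypotheses (a_gt0 : 0 < a) (L_ge0 : 0 <= L) (eta_ge0 : 0 <= eta).
Hypothesis T_bound : forall x, rnorm (T x) <= L * rnorm x.
Hypothesis T_bound' : forall x, rnorm (T' x) <= L * rnorm x.
Hypothesis TT' : forall x, rnorm (T x - T' x) <= eta * rnorm x.
Local Notation P := (shift_op (T \o S) a).
Local Notation P' := (shift_op (T' \o S') a).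
Local Notation W := (inv_op (sqrt_op P)).
Local Notation W' := (inv_op (sqrt_op P')).

Let SS' y : rnorm (S y - S' y) <= eta * rnorm y.
Proof. exact: (adjoint_pair_bound (adjoint_pair_sub TS TS')). Qed.
Let sa_gt0 : 0 < Num.sqrt a. Proof. by rewrite sqrtr_gt0. Qed.
Let sa2 : Num.sqrt a ^+ 2 = a. Proof. by rewrite sqr_sqrtr // ltW. Qed.

(** [shift_estimate] absorbs the outer [T] of one of the two error terms, so [L] does not enter the
    bound. *)
Lemma shift_inv_diff z :
  Num.sqrt a * a * rnorm (inv_op P z - inv_op P' z) <= 2 * eta * rnorm z.
Proof.
set u' := inv_op P' z.
have Pu' : T' (S' u') + ofr a *: u' = z.
  exact: (shift_invK TS' a_gt0 L_ge0 T_bound' z).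
(* T S - T' S' = (T - T') S' + T (S - S') *)
have Px : P (inv_op P z - u') = (T' (S' u') - T (S' u')) + T (S' u' - S u').
  rewrite (adjoint_pairB (shift_adjoint a TS)) (shift_invK TS a_gt0 L_ge0 T_bound).
  rewrite -{1}Pu' /shift_op /= (adjoint_pairB TS) opprD addrACA subrr addr0.
  by rewrite subrKA.
have [+ _] := shift_estimate TS a_gt0 Px; rewrite (rnormC (T' _)) (rnormC (S' u')) => h1.
have h2 := ler_wpM2l (ltW sa_gt0) h1.
have h3 := ler_wpM2l (ltW sa_gt0) (TT' (S' u')).
have h4 := ler_wpM2l (ltW a_gt0) (SS' u').
have h5 := ler_wpM2l eta_ge0 (shift_inv_bound TS' a_gt0 L_ge0 T_bound' z).
have h6 := ler_wpM2l eta_ge0 (shift_inv_adjoint_bound TS' a_gt0 L_ge0 T_bound' z).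
rewrite -/u' in h5 h6.
move: h2 h3 h4 h5 h6; rewrite mulrDr (mulrA _ (Num.sqrt a)) -expr2 sa2; lra.
Qed.

(** A relative comparison of the energies of P^(-1/2) u and P'^(-1/2) u: with [v] and [v'] the two
    inverses at [u], the first energy is the P'-form of [v] and [v'], and |S' v| <= |S v| + sqrt a
    |v|. *)
Lemma sqrt_shift_inv_perturb u : eta ^+ 2 <= a ->
  rnorm (W u) <= 2 * rnorm (W' u).
Proof.
move=> eta_a; have eta_sa : eta <= Num.sqrt a.
  by rewrite -(@ler_pXn2r _ 2)// ?nnegrE ?sqrtr_ge0// sa2.
rewrite -(@ler_pXn2r _ 2)// ?nnegrE ?mulr_ge0 ?rnorm_ge0// exprMn.
rewrite (sqrt_shift_inv_energy TS a_gt0 L_ge0 T_bound).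
rewrite (sqrt_shift_inv_energy TS' a_gt0 L_ge0 T_bound').
have Puu : rinner (inv_op P u) u =
    a * rnorm (inv_op P u) ^+ 2 + rnorm (S (inv_op P u)) ^+ 2.
  by rewrite -(shift_energy a TS) (shift_invK TS a_gt0 L_ge0 T_bound) rinnerC.
have Pu' : T' (S' (inv_op P' u)) + ofr a *: inv_op P' u = u.
  exact: (shift_invK TS' a_gt0 L_ge0 T_bound' u).
set v := inv_op P u in Puu *; set v' := inv_op P' u in Pu' *.
have := Puu; rewrite -{1}Pu' rinnerDr rinnerZr rinnerC (rinner_adjoint TS') rinnerC.
have h1 := rinner_le (S' v) (S' v'); have h2 := rinner_le v v'.
have h3 : rnorm (S' v) <= rnorm (S v) + Num.sqrt a * rnorm v.
  have := ler_rnormD (S' v - S v) (S v); rewrite subrK addrC => /le_trans; apply.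
  rewrite lerD2l rnormC (le_trans (SS' v))// ler_wpM2r ?rnorm_ge0//.
have h4 := ler_wpM2r (rnorm_ge0 (S' v')) h3.
have h5 := ler_wpM2l (ltW a_gt0) h2.
move: sa2 h1 h4 h5; set al := rnorm (S v); set ga := rnorm (S' v').
move: (Num.sqrt a) (rnorm v) (rnorm v') (rnorm (S' v)) (rinner (S' v) (S' v')) (rinner v v').
move: al ga => al ga si be de x y1 y2 <- h1 h4 h5 E.
(* These squares are Young inequalities that absorb [al] and [be] on the left, with factor 4 for the
   squared norms. *)
have := sqr_ge0 al; have := sqr_ge0 (al + si * be - 2 * ga); have := sqr_ge0 (al - si * be).
have := sqr_ge0 (si * be - 2 * (si * de)); move: h1 h4 h5 E; lra.
Qed.

End Perturbation.

End Hilbert.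

(** * Tikhonov solutions and heuristic functionals *)

Section Functionals.
Variables (R : realType) (F : scalars).
Local Notation ofr := (@of_real R F).

Section TikhonovPsi.
Variables (X Y : hilbertType R F) (T : X -> Y) (a L : R).
Hypotheses (TS : adjoint_pair T (adjoint T)) (a_gt0 : 0 < a) (L_ge0 : 0 <= L).
Hypothesis T_bound : forall x, rnorm (T x) <= L * rnorm x.
Local Notation S := (adjoint T).
Local Notation P := (shift_op (T \o S) a).
Local Notation Q := (shift_op (S \o T) a).
Local Notation W := (inv_op (sqrt_op P)).

Let ST : adjoint_pair S T := adjoint_pair_sym TS.
Let S_bound := adjoint_pair_bound TS L_ge0 T_bound.
Let sa_gt0 : 0 < Num.sqrt a. Proof. by rewrite sqrtr_gt0. Qed.
Let sa2 : Num.sqrt a ^+ 2 = a. Proof. by rewrite sqr_sqrtr // ltW. Qed.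
Let PinvP := shift_inv_adjoint TS a_gt0 L_ge0 T_bound.
Let QinvP := shift_inv_adjoint ST a_gt0 L_ge0 S_bound.
Let WP := sqrt_shift_inv_adjoint TS a_gt0 L_ge0 T_bound.

Lemma tikhonovD z w : tikhonov a T (z + w) = tikhonov a T z + tikhonov a T w.
Proof. by rewrite /tikhonov (adjoint_pairD ST) (adjoint_pairD QinvP). Qed.

Lemma tikhonov_bound z : Num.sqrt a * rnorm (tikhonov a T z) <= rnorm z.
Proof. exact: (shift_inv_range_bound ST a_gt0 L_ge0 S_bound). Qed.

Lemma tikhonov_image_bound z : rnorm (T (tikhonov a T z)) <= rnorm z.
Proof. exact: (shift_inv_range_bound2 ST a_gt0 L_ge0 S_bound). Qed.

Lemma tikhonov_bias v :
  rnorm (tikhonov a T (T v) - v) = a * rnorm (inv_op Q v).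
Proof.
rewrite /tikhonov (shift_inv_residual ST a_gt0 L_ge0 S_bound).
by rewrite addrAC subrr add0r rnormN rnormZ (ger0_norm (ltW a_gt0)).
Qed.

Lemma tikhonov_bias_bound v : rnorm (tikhonov a T (T v) - v) <= rnorm v.
Proof. by rewrite tikhonov_bias (shift_inv_bound ST a_gt0 L_ge0 S_bound). Qed.

Lemma tikhonov_bias_source w :
  rnorm (tikhonov a T (T (S w)) - S w) <= Num.sqrt a * rnorm w.
Proof.
rewrite tikhonov_bias -{1}sa2 expr2 -mulrA ler_wpM2l ?sqrtr_ge0//.
exact: (shift_inv_range_bound ST a_gt0 L_ge0 S_bound).
Qed.

Lemma psi_HDE z : psi_HD a T z = Num.sqrt a * rnorm (inv_op P z).
Proof. by rewrite /psi_HD rnormZ ger0_norm ?sqrtr_ge0. Qed.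

Lemma psi_HRE z : psi_HR a T z = a * rnorm (W (inv_op P z)).
Proof.
rewrite /psi_HR rnormZ (ger0_norm (ltW a_gt0)) /pow_m3half /=.
by rewrite (sqrt_shift_inv2 TS a_gt0 L_ge0 T_bound z).
Qed.

Lemma psi_QOE z : psi_QO a T z = a * rnorm (inv_op Q (tikhonov a T z)).
Proof. by rewrite /psi_QO rnormZ (ger0_norm (ltW a_gt0)). Qed.

(** P^(-1/2) has norm at most a^(-1/2), so upper bounds for Hanke-Raus follow from those for the
    discrepancy. *)
Lemma psi_HR_le z : psi_HR a T z <= psi_HD a T z.
Proof.
rewrite psi_HRE psi_HDE -{1}sa2 expr2 -mulrA ler_wpM2l ?sqrtr_ge0//.
exact: (sqrt_shift_inv_bound TS a_gt0 L_ge0 T_bound).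
Qed.

Lemma psi_QO_le z : psi_QO a T z <= rnorm (tikhonov a T z).
Proof. by rewrite psi_QOE (shift_inv_bound ST a_gt0 L_ge0 S_bound). Qed.

Variable h : heuristic.

Lemma psi_ge0 z : 0 <= psi h a T z.
Proof. by case: h; exact: rnorm_ge0. Qed.

Lemma psiD z w : psi h a T (z + w) <= psi h a T z + psi h a T w.
Proof.
case: h => /=.
- rewrite !psi_HDE -mulrDr ler_wpM2l ?sqrtr_ge0//.
  by rewrite (adjoint_pairD PinvP) ler_rnormD.
- rewrite !psi_HRE -mulrDr (ler_wpM2l (ltW a_gt0))//.
  by rewrite (adjoint_pairD PinvP) (adjoint_pairD WP) ler_rnormD.
- rewrite !psi_QOE -mulrDr (ler_wpM2l (ltW a_gt0))//.
  by rewrite tikhonovD (adjoint_pairD QinvP) ler_rnormD.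
Qed.

Lemma psiN z : psi h a T (- z) = psi h a T z.
Proof.
case: h => /=.
- by rewrite !psi_HDE (adjoint_pairN PinvP) rnormN.
- by rewrite !psi_HRE (adjoint_pairN PinvP) (adjoint_pairN WP) rnormN.
- rewrite !psi_QOE /tikhonov (adjoint_pairN ST) !(adjoint_pairN QinvP).
  by rewrite rnormN.
Qed.

Lemma psi_bound z : Num.sqrt a * psi h a T z <= rnorm z.
Proof.
have hd : Num.sqrt a * psi_HD a T z <= rnorm z.
  rewrite psi_HDE mulrA -expr2 sa2.
  exact: (shift_inv_bound TS a_gt0 L_ge0 T_bound).
case: h => //=.
- by apply: le_trans hd; rewrite ler_wpM2l ?sqrtr_ge0 // psi_HR_le.
- apply: le_trans (tikhonov_bound z).
  by rewrite ler_wpM2l ?sqrtr_ge0 // psi_QO_le.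
Qed.

(** The factor 2 comes from quasioptimality: the Tikhonov solution for data [T v] is [v] plus a bias
    of norm at most |v|. *)
Lemma psi_range v : psi h a T (T v) <= 2 * rnorm v.
Proof.
have v0 := rnorm_ge0 v.
have hd : psi_HD a T (T v) <= 2 * rnorm v.
  rewrite psi_HDE (le_trans (shift_inv_range_bound TS a_gt0 L_ge0 T_bound v))//.
  lra.
case: h => //=; first exact: le_trans (psi_HR_le _) hd.
rewrite (le_trans (psi_QO_le _))//.
have := ler_rnormD (tikhonov a T (T v) - v) v; rewrite subrK.
have := tikhonov_bias_bound v; lra.
Qed.

Lemma psi_source w : psi h a T (T (S w)) <= 2 * Num.sqrt a * rnorm w.
Proof.
have hd : psi_HD a T (T (S w)) <= 2 * Num.sqrt a * rnorm w.
  rewrite psi_HDE (shift_inv_residual TS a_gt0 L_ge0 T_bound).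
  rewrite -mulrA mulrCA ler_wpM2l ?sqrtr_ge0//.
  have := ler_rnormD w (- (ofr a *: inv_op P w)).
  rewrite rnormN rnormZ (ger0_norm (ltW a_gt0)).
  have := shift_inv_bound TS a_gt0 L_ge0 T_bound w; lra.
case: h => //=; first exact: le_trans (psi_HR_le _) hd.
rewrite psi_QOE -[tikhonov _ _ _](subrK (S w)) (adjoint_pairD QinvP).
have /(ler_wpM2l (ltW a_gt0)) :=
  ler_rnormD (inv_op Q (tikhonov a T (T (S w)) - S w)) (inv_op Q (S w)).
have := shift_inv_bound ST a_gt0 L_ge0 S_bound (tikhonov a T (T (S w)) - S w).
have := tikhonov_bias_source w.
have := ler_wpM2l (ltW sa_gt0) (shift_inv_range_bound ST a_gt0 L_ge0 S_bound w).
rewrite mulrA -expr2 sa2; lra.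
Qed.

(** Undoing each inverse costs a factor [L ^+ 2 + a], and undoing P^(-1/2) also costs a^(-1/2).
    Quasioptimality sees the data only through [S z]; its spare sqrt a is what the factor [1 + a]
    absorbs. *)
Lemma psi_lower z :
  Num.sqrt a * a * (match h with HD | HR => rnorm z | QO => rnorm (S z) end)
    <= (1 + a) * (L ^+ 2 + a) ^+ 2 * psi h a T z.
Proof.
have M0 : 0 < L ^+ 2 + a by rewrite ltr_wpDl ?sqr_ge0.
have aM : a <= L ^+ 2 + a by rewrite lerDr sqr_ge0.
have a0 := ltW a_gt0.
have K1 : (L ^+ 2 + a) ^+ 2 * psi h a T z <=
    (1 + a) * (L ^+ 2 + a) ^+ 2 * psi h a T z.
  by have := mulr_ge0 a0 (mulr_ge0 (sqr_ge0 (L ^+ 2 + a)) (psi_ge0 z)); lra.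
case: h K1 => /= K1.
- apply: le_trans K1; have := shift_inv_lower TS a_gt0 L_ge0 T_bound z.
  rewrite psi_HDE => /(ler_wpM2l (mulr_ge0 (ltW sa_gt0) a0)) /le_trans; apply.
  have := mulr_ge0 (mulr_ge0 (ltW sa_gt0) (ltW M0)) (rnorm_ge0 (inv_op P z)).
  move/ler_wpM2l => /(_ _ _ aM); lra.
- apply: le_trans K1; have := shift_inv_lower TS a_gt0 L_ge0 T_bound z.
  rewrite psi_HRE => /(ler_wpM2l (mulr_ge0 (ltW sa_gt0) a0)).
  have := sqrt_shift_inv_lower TS a_gt0 L_ge0 T_bound (inv_op P z).
  move/(ler_wpM2l (mulr_ge0 (ltW M0) a0)); lra.
- rewrite psi_QOE.
  have h1 := shift_inv_lower ST a_gt0 L_ge0 S_bound (S z).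
  have h2 := shift_inv_lower ST a_gt0 L_ge0 S_bound (tikhonov a T z).
  have {h1}h2 := le_trans h1 (ler_wpM2l (ltW M0) h2).
  have s1 : Num.sqrt a <= 1 + a.
    by have := sqr_ge0 (Num.sqrt a - 1); have := ltW sa_gt0; move: sa2; lra.
  rewrite -[leLHS]mulrA -[leRHS]mulrA.
  apply: ler_pM => //; rewrite ?sqrtr_ge0 ?mulr_ge0 ?rnorm_ge0//.
  by have := ler_wpM2l a0 h2; lra.
Qed.

End TikhonovPsi.

(** * Stability of Tikhonov solutions and functionals under operator noise *)

Section PsiPerturbation.
Variables (X Y : hilbertType R F) (T T' : X -> Y) (a L eta : R).
Hypotheses (TS : adjoint_pair T (adjoint T)) (TS' : adjoint_pair T' (adjoint T')).
Hypotheses (a_gt0 : 0 < a) (L_ge0 : 0 <= L) (eta_ge0 : 0 <= eta).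
Hypothesis T_bound : forall x, rnorm (T x) <= L * rnorm x.
Hypothesis T_bound' : forall x, rnorm (T' x) <= L * rnorm x.
Hypothesis TT' : forall x, rnorm (T x - T' x) <= eta * rnorm x.

Let ST := adjoint_pair_sym TS.
Let ST' := adjoint_pair_sym TS'.
Let S_bound := adjoint_pair_bound TS L_ge0 T_bound.
Let S_bound' := adjoint_pair_bound TS' L_ge0 T_bound'.
Let SS' y : rnorm (adjoint T y - adjoint T' y) <= eta * rnorm y.
Proof. exact: (adjoint_pair_bound (adjoint_pair_sub TS TS')). Qed.
Let sa_gt0 : 0 < Num.sqrt a. Proof. by rewrite sqrtr_gt0. Qed.
Let sa2 : Num.sqrt a ^+ 2 = a. Proof. by rewrite sqr_sqrtr // ltW. Qed.

(** Applying T^* T + a to the difference leaves the adjoint error at the residual [z - T' x'], of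
    norm at most 2 |z|, plus T^* of the operator error at [x']; hence 3 = 2 + 1. *)
Lemma tikhonov_diff z :
  a * rnorm (tikhonov a T z - tikhonov a T' z) <= 3 * eta * rnorm z.
Proof.
set x' := tikhonov a T' z.
have Qx' : adjoint T' (T' x') + ofr a *: x' = adjoint T' z.
  exact: (shift_invK ST' a_gt0 L_ge0 S_bound').
have Qx : shift_op (adjoint T \o T) a (tikhonov a T z - x') =
    (adjoint T (z - T' x') - adjoint T' (z - T' x')) + adjoint T (- (T x' - T' x')).
  rewrite (adjoint_pairB (shift_adjoint a ST)) (shift_invK ST a_gt0 L_ge0 S_bound).
  rewrite !(adjoint_pairB ST) !(adjoint_pairB ST') -Qx' /shift_op /=.
  rewrite (adjoint_pairN ST) (adjoint_pairB ST).
  set A1 := adjoint T z; set A2 := adjoint T (T x'); set A3 := adjoint T (T' x').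
  set A4 := adjoint T' _; set A5 := ofr a *: x'.
  rewrite [A4 + A5 - A4]addrC addKr [- (A2 - A3)]opprB opprD.
  by rewrite addrA [LHS]addrAC [A1 - A3 - A5]addrAC addrA subrK.
have [+ _] := shift_estimate ST a_gt0 Qx; rewrite rnormN => h1.
have h2 := SS' (z - T' x').
have h3 := ler_wpM2l (ltW sa_gt0) (TT' x').
have h4 := ler_wpM2l eta_ge0 (tikhonov_bound TS' a_gt0 L_ge0 T_bound' z).
have h5 := ler_rnormD z (- T' x').
have h6 := tikhonov_image_bound TS' a_gt0 L_ge0 T_bound' z.
rewrite -/x' rnormN in h4 h5 h6.
have h7 := ler_wpM2l eta_ge0 h5; have h8 := ler_wpM2l eta_ge0 h6.
move: h1 h2 h3 h4 h7 h8; lra.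
Qed.

(** The factor 2 is the relative error of P^(-1/2) in Hanke-Raus. The 5 is due to quasioptimality: 3
    for the Tikhonov solution and 2 for the outer inverse. *)
Lemma psi_perturb h z : eta ^+ 2 <= a ->
  a * psi h a T z <= 2 * a * psi h a T' z + 5 * eta * rnorm z.
Proof.
move=> eta_a; have a0 := ltW a_gt0.
have D := shift_inv_diff TS TS' a_gt0 L_ge0 eta_ge0 T_bound T_bound' TT' z.
have etaz := mulr_ge0 eta_ge0 (rnorm_ge0 z).
set P := shift_op (T \o adjoint T) a in D *.
set P' := shift_op (T' \o adjoint T') a in D *.
have := psi_ge0 T' a h z; case: h => /= psi0.
- move: psi0; rewrite !psi_HDE // -/P -/P' => psi0.
  have := ler_rnormD (inv_op P z - inv_op P' z) (inv_op P' z); rewrite subrK.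
  move/(ler_wpM2l (mulr_ge0 (ltW sa_gt0) a0)).
  by have := mulr_ge0 a0 psi0; move: D etaz; lra.
- rewrite (psi_HRE TS a_gt0 L_ge0 T_bound) (psi_HRE TS' a_gt0 L_ge0 T_bound') -/P -/P'.
  have WP := sqrt_shift_inv_adjoint TS a_gt0 L_ge0 T_bound.
  set u := inv_op P z; set u' := inv_op P' z; rewrite -/u -/u' in D.
  rewrite -/P in WP; set W := inv_op (sqrt_op P) in WP *.
  have := sqrt_shift_inv_perturb TS TS' a_gt0 L_ge0 eta_ge0 T_bound T_bound' TT' u' eta_a.
  rewrite -/P -/P' -/W => h1.
  have := sqrt_shift_inv_bound TS a_gt0 L_ge0 T_bound (u - u'); rewrite -/P -/W => h2.
  have := ler_rnormD (W (u - u')) (W u'); rewrite -(adjoint_pairD WP) subrK => h3.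
  have k1 := ler_wpM2l (mulr_ge0 a0 a0) h1.
  have k2 := ler_wpM2l (mulr_ge0 (ltW sa_gt0) a0) h2.
  have k3 := ler_wpM2l (mulr_ge0 a0 a0) h3.
  rewrite mulrACA -expr2 sa2 mulrA in k2.
  by move: k1 k2 k3 D etaz; lra.
- rewrite (psi_QOE _ a_gt0) (psi_QOE _ a_gt0).
  set Q := shift_op (adjoint T \o T) a; set Q' := shift_op (adjoint T' \o T') a.
  set x := tikhonov a T z; set x' := tikhonov a T' z.
  have QP := shift_inv_adjoint ST a_gt0 L_ge0 S_bound.
  have := ler_rnormD (inv_op Q (x - x')) (inv_op Q x').
  rewrite -(adjoint_pairD QP) subrK => h1.
  have := ler_rnormD (inv_op Q x' - inv_op Q' x') (inv_op Q' x'); rewrite subrK => h2.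
  have h3 := shift_inv_bound ST a_gt0 L_ge0 S_bound (x - x').
  have h4 := shift_inv_diff ST ST' a_gt0 L_ge0 eta_ge0 S_bound S_bound' SS' x'.
  have h5 := tikhonov_diff z.
  have h6 := ler_wpM2l eta_ge0 (tikhonov_bound TS' a_gt0 L_ge0 T_bound' z).
  rewrite -/Q -/Q' -/x -/x' in h3 h4 h5 h6.
  have k1 := ler_wpM2l (mulr_ge0 a0 a0) h1.
  have k2 := ler_wpM2l (mulr_ge0 a0 a0) h2.
  have k3 := ler_wpM2l a0 h3.
  have k4 := ler_wpM2l (ltW sa_gt0) h4.
  rewrite !mulrA -expr2 sa2 in k4.
  have psi1 := mulr_ge0 a0 psi0; rewrite (psi_QOE _ a_gt0) -/Q' -/x' in psi1.
  by move: k1 k2 k3 k4 h5 h6 psi1; lra.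
Qed.

End PsiPerturbation.


(** The residual of the projection onto the closed range of [S] is orthogonal to that range, hence
    in the kernel of [T], which is trivial. *)
Lemma range_adjoint_dense (X Y : hilbertType R F) (T : X -> Y) (S : Y -> X) :
  adjoint_pair T S -> injective T ->
  forall x e, 0 < e -> exists w, rnorm (x - S w) < e.
Proof.
move=> TS Tinj x e e0; have ST := adjoint_pair_sym TS.
have [] := @orthogonal_projection _ _ _ (range S) x.
- by exists 0 => //; rewrite (adjoint_pair0 ST).
- by move=> _ _ [u _ <-] [v _ <-]; exists (u + v) => //; rewrite (adjoint_pairD ST).
- by move=> a _ [v _ <-]; exists (ofr a *: v) => //; rewrite (adjoint_pairZ ST).
move=> p [hp orth].
have Txp : T (x - p) = 0.
  apply: rnorm0_eq0; apply/eqP; rewrite -sqrf_eq0 rnorm_sqr.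
  by rewrite (rinner_adjoint TS) orth //; exists (T (x - p)).
have -> : x = p.
  by apply/eqP; rewrite -subr_eq0; apply/eqP/Tinj; rewrite Txp (adjoint_pair0 TS).
by have [_ [w _ <-] hw] := hp e e0; exists w.
Qed.

(** * Error estimates for a fixed regularization parameter *)

Section ErrorEstimates.
Variables (X Y : hilbertType R F) (A T : X -> Y) (a L eta : R).
Hypotheses (AS : adjoint_pair A (adjoint A)) (TS : adjoint_pair T (adjoint T)).
Hypotheses (a_gt0 : 0 < a) (L_ge0 : 0 <= L) (eta_ge0 : 0 <= eta).
Hypothesis A_bound : forall x, rnorm (A x) <= L * rnorm x.
Hypothesis T_bound : forall x, rnorm (T x) <= L * rnorm x.
Hypothesis AT : forall x, rnorm (A x - T x) <= eta * rnorm x.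
Variables (x : X) (w : Y) (tau : R) (h : heuristic).
Hypothesis x_source : rnorm (x - adjoint A w) <= tau.

Let sa_gt0 : 0 < Num.sqrt a. Proof. by rewrite sqrtr_gt0. Qed.
(** The summands are the approximation error of the source element, the adjoint perturbation A^* w -
    T^* w, and an exact source element for [T]. *)
Let x_split : exists u v,
  [/\ x = u + v + adjoint T w, rnorm u <= tau & rnorm v <= eta * rnorm w].
Proof.
exists (x - adjoint A w), (adjoint A w - adjoint T w).
split=> //; first by rewrite addrA !subrK.
exact: (adjoint_pair_bound (adjoint_pair_sub AS TS)).
Qed.

Lemma psi_range_source :
  psi h a T (T x) <= 2 * (tau + (eta + Num.sqrt a) * rnorm w).
Proof.
have [u [v [-> hu hv]]] := x_split; rewrite !(adjoint_pairD TS).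
have h1 := psiD TS a_gt0 L_ge0 T_bound h (T u + T v) (T (adjoint T w)).
have h2 := psiD TS a_gt0 L_ge0 T_bound h (T u) (T v).
have h3 := psi_range TS a_gt0 L_ge0 T_bound h u.
have h4 := psi_range TS a_gt0 L_ge0 T_bound h v.
have h5 := psi_source TS a_gt0 L_ge0 T_bound h w.
by move: h1 h2 h3 h4 h5; lra.
Qed.

Lemma tikhonov_bias_source_approx :
  rnorm (tikhonov a T (T x) - x) <= tau + (eta + Num.sqrt a) * rnorm w.
Proof.
have [u [v [-> hu hv]]] := x_split.
rewrite !(adjoint_pairD TS) !(tikhonovD TS a_gt0 L_ge0 T_bound).
rewrite !opprD addrACA [X in X + _]addrACA.
have := ler_rnormD (tikhonov a T (T u) - u + (tikhonov a T (T v) - v))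
   (tikhonov a T (T (adjoint T w)) - adjoint T w).
have := ler_rnormD (tikhonov a T (T u) - u) (tikhonov a T (T v) - v).
have := tikhonov_bias_bound TS a_gt0 L_ge0 T_bound u.
have := tikhonov_bias_bound TS a_gt0 L_ge0 T_bound v.
have := tikhonov_bias_source TS a_gt0 L_ge0 T_bound w.
lra.
Qed.

Lemma psi_exact :
  psi h a T (A x) <= 2 * (tau + (eta + Num.sqrt a) * rnorm w)
    + eta / Num.sqrt a * rnorm x.
Proof.
have := psiD TS a_gt0 L_ge0 T_bound h (T x) (A x - T x).
rewrite [T x + _]addrC subrK => h1.
have h2 := le_trans (psi_bound TS a_gt0 L_ge0 T_bound h (A x - T x)) (AT x).
have {}h2 : psi h a T (A x - T x) <= eta / Num.sqrt a * rnorm x.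
  by rewrite mulrAC ler_pdivlMr // mulrC.
by have := psi_range_source; move: h1 h2; lra.
Qed.

Lemma tikhonov_error z (delta Cnc : R) : eta ^+ 2 <= a -> 0 <= Cnc ->
  rnorm (z - A x) <= delta ->
  rnorm (tikhonov a A (z - A x)) <= Cnc * psi h a A (z - A x) ->
  rnorm (tikhonov a T z - x) <= 2 * Cnc * psi h a T z
    + (4 * Cnc + 1) * (tau + (eta + Num.sqrt a) * rnorm w)
    + (2 * Cnc + 1) * (eta / Num.sqrt a * rnorm x)
    + (5 * Cnc + 3) * (eta / a * delta).
Proof.
move=> eta_a Cnc0 hz noise; set n := z - A x in hz noise *.
have h1 := tikhonov_diff AS TS a_gt0 L_ge0 eta_ge0 A_bound T_bound AT n.
have h2 := psi_perturb AS TS a_gt0 L_ge0 eta_ge0 A_bound T_bound AT h n eta_a.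
have etaz := ler_wpM2l eta_ge0 hz.
have {}h1 : rnorm (tikhonov a A n - tikhonov a T n) <= 3 * (eta / a * delta).
  rewrite mulrAC mulrA ler_pdivlMr // mulrC (le_trans h1)//.
  by rewrite -mulrA ler_wpM2l.
have {}h2 : psi h a A n <= 2 * psi h a T n + 5 * (eta / a * delta).
  rewrite -(ler_pM2l a_gt0) mulrDr.
  have -> : a * (5 * (eta / a * delta)) = 5 * (eta * delta).
    by field; rewrite lt0r_neq0.
  by move: h2 etaz; lra.
have h3 : psi h a T n <= psi h a T z + psi h a T (A x).
  by rewrite -(psiN TS a_gt0 L_ge0 T_bound h (A x)) (psiD TS a_gt0 L_ge0 T_bound).
have h4 := psi_exact.
have h5 : rnorm (tikhonov a T (A x - T x)) <= eta / Num.sqrt a * rnorm x.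
  rewrite mulrAC ler_pdivlMr // mulrC.
  exact: le_trans (tikhonov_bound TS a_gt0 L_ge0 T_bound _) (AT x).
have h6 := tikhonov_bias_source_approx.
(* The total error splits into propagated data noise, operator noise at [x], and bias for data
   [T x]. Only the first passes through the noise condition and carries [Cnc]. *)
have := ler_rnormD (tikhonov a T n) (tikhonov a T (A x - T x) + (tikhonov a T (T x) - x)).
have := ler_rnormD (tikhonov a T (A x - T x)) (tikhonov a T (T x) - x).
rewrite !addrA -!(tikhonovD TS a_gt0 L_ge0 T_bound) -[n + _ + _]addrA !subrK.
have := ler_rdistD (tikhonov a A n) (tikhonov a T n) 0.
rewrite !subr0 (rnormC (tikhonov a T n)).
have k1 := ler_wpM2l Cnc0 h2; have k2 := ler_wpM2l Cnc0 h3; have k3 := ler_wpM2l Cnc0 h4.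
by move: noise h1 h5 h6 k1 k2 k3; lra.
Qed.

End ErrorEstimates.

(** * The functional at the selected parameter *)

Section ParameterChoice.
Variables (X Y : hilbertType R F) (A T : X -> Y) (a b g amax L eta D : R).
Hypotheses (AS : adjoint_pair A (adjoint A)) (TS : adjoint_pair T (adjoint T)).
Hypotheses (g_gt0 : 0 < g) (L_ge0 : 0 <= L) (eta_ge0 : 0 <= eta) (D_ge0 : 0 <= D).
Hypothesis T_bound : forall x, rnorm (T x) <= L * rnorm x.
Hypothesis AT : forall x, rnorm (A x - T x) <= eta * rnorm x.
Variables (x : X) (w z : Y) (tau delta : R) (h : heuristic) (s : semiheuristic).
Hypothesis x_source : rnorm (x - adjoint A w) <= tau.
Hypotheses (delta_gt0 : 0 < delta) (hz : rnorm (z - A x) <= delta).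
Hypothesis a_min : argmin `[g, amax] (fun a => psi_bar h s D eta a T z) a.
Hypotheses (gb : g <= b) (db : delta <= b) (bmax : b <= amax).

(** Compare with the competitor [b]: its nonnegative penalty is dropped, while the penalty at [a] is
    controlled because [g <= a]. *)
Lemma psi_argmin :
  psi h a T z <= Num.sqrt delta + 2 * (tau + (eta + Num.sqrt b) * rnorm w)
    + (rnorm x + D * (rnorm z + 1)) * (eta / Num.sqrt g).
Proof.
have [/andP[ga aamax] amin] := a_min; rewrite !bnd_simp in ga aamax.
have a_gt0 : 0 < a by apply: lt_le_trans ga.
have b_gt0 : 0 < b by apply: lt_le_trans gb.
have sg_gt0 : 0 < Num.sqrt g by rewrite sqrtr_gt0.
have sqrt_mono c : g <= c -> eta / Num.sqrt c <= eta / Num.sqrt g.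
  move=> gc; have c0 : 0 < c by apply: lt_le_trans gc.
  by rewrite ler_wpM2l // lef_pV2 ?posrE ?sqrtr_gt0 // ler_wsqrtr.
have hb : psi_bar h s D eta a T z <= psi_bar h s D eta b T z.
  by apply: amin; rewrite /= in_itv /= gb bmax.
have hb2 : psi_bar h s D eta b T z <= psi h b T z.
  rewrite /psi_bar; case: s.
    by rewrite lerBlDr lerDl !mulr_ge0 ?rnorm_ge0.
  by rewrite lerBlDr lerDl divr_ge0 ?sqrtr_ge0 // mulr_ge0.
have rho_ge0 : 0 <= eta / Num.sqrt g by rewrite divr_ge0 ?sqrtr_ge0.
(* In [rnorm z + 1] the first term serves (SH1), where the Tikhonov norm is at most |z| / sqrt a,
   and the 1 serves (SH2). *)
have ha : psi h a T z <= psi_bar h s D eta a T z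
    + D * (rnorm z + 1) * (eta / Num.sqrt g).
  have := sqrt_mono a ga => rho_a.
  rewrite /psi_bar.
  have h1 : D * eta * rnorm (tikhonov a T z) <= D * (rnorm z * (eta / Num.sqrt g)).
    rewrite -mulrA ler_wpM2l // mulrC.
    apply: (@le_trans _ _ (rnorm z * (eta / Num.sqrt a))).
      rewrite mulrCA mulrC ler_wpM2l // ler_pdivlMr ?sqrtr_gt0 // mulrC.
      exact: (tikhonov_bound TS a_gt0 L_ge0 T_bound).
    by rewrite ler_wpM2l ?rnorm_ge0.
  have h2 : D * eta / Num.sqrt a <= D * (eta / Num.sqrt g).
    by rewrite -mulrA ler_wpM2l.
  have h3 : 0 <= D * (eta / Num.sqrt g) by rewrite mulr_ge0.
  have h4 := mulr_ge0 D_ge0 (mulr_ge0 (rnorm_ge0 z) rho_ge0).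
  by case: s; move: h1 h2 h3 h4; lra.
have hb3 := psiD TS b_gt0 L_ge0 T_bound h (A x) (z - A x).
rewrite [A x + _]addrC subrK in hb3.
have hb4 := psi_exact AS TS b_gt0 L_ge0 eta_ge0 T_bound AT h x_source.
(* The noise contributes at most delta / sqrt b, and [delta <= b]. *)
have hb5 : psi h b T (z - A x) <= Num.sqrt delta.
  have hd := le_trans (psi_bound TS b_gt0 L_ge0 T_bound h (z - A x)) hz.
  have sd : Num.sqrt delta ^+ 2 = delta by rewrite sqr_sqrtr // ltW.
  rewrite -sd in hd.
  rewrite -(@ler_pM2l _ (Num.sqrt b)) ?sqrtr_gt0// (le_trans hd)//.
  by rewrite expr2 ler_wpM2r ?sqrtr_ge0 // ler_wsqrtr.
have := ler_wpM2r (rnorm_ge0 x) (sqrt_mono b gb).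
by move: hb hb2 ha hb3 hb4 hb5; lra.
Qed.

End ParameterChoice.

End Functionals.

(** * Convergence of the selected Tikhonov solutions *)

Lemma sqrtr_lt (R : rcfType) (c d : R) : 0 < c -> d < c ^+ 2 -> Num.sqrt d < c.
Proof.
by move=> c0 dc; rewrite -[ltRHS]ger0_norm ?ltW// -sqrtr_sqr ltr_sqrt // exprn_gt0.
Qed.

Theorem theorem1 (R : realType) (F : scalars) (X Y : hilbertType R F)
    (A : {linear X -> Y}) (y : Y) (xdag : X) (alpha_max D : R)
    (y_ : R -> Y) (A_ : R -> {linear X -> Y})
    (h : heuristic) (s : semiheuristic)
    (gamma : R -> R) (alpha_star : R -> R -> R)
    (A_bounded : continuous A)
    (A_range : ~ closed (range A))
    (A_inj : injective A)
    (xdag_min : min_norm_least_squares A y xdag)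
    (attainable : y = A xdag)
    (alpha_max_gt0 : 0 < alpha_max)
    (y_noise : forall delta, 0 < delta -> rnorm (y_ delta - y) <= delta)
    (A_eta_bounded : forall eta, 0 < eta -> continuous (A_ eta))
    (A_noise : forall eta, 0 < eta -> opnorm (A_ eta \- A) <= eta)
    (D_gt0 : 0 < D)
    (gamma_range : forall eta, 0 < eta -> 0 < gamma eta <= alpha_max)
    (gamma_to0 : gamma eta @[eta --> 0^'+] --> (0 : R))
    (alpha_starP : forall delta eta, 0 < delta -> 0 < eta ->
       argmin `[gamma eta, alpha_max]
         (fun a => psi_bar h s D eta a (A_ eta) (y_ delta))
         (alpha_star delta eta))
    (noise_condition : exists Cnc : R, 0 < Cnc /\
       forall delta, 0 < delta -> forall a, 0 < a <= alpha_max ->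
         rnorm (tikhonov a A (y_ delta - y)) <= Cnc * psi h a A (y_ delta - y))
    (data_lower_bound : exists C : R, 0 < C /\
       forall delta eta, 0 < delta -> 0 < eta ->
         match h with
         | HD | HR => C <= rnorm (y_ delta)
         | QO => C <= rnorm (adjoint (A_ eta) (y_ delta))
         end)
    (eta_sqrt_gamma : eta / Num.sqrt (gamma eta) @[eta --> 0^'+] --> (0 : R))
    (eta_gamma : exists C' : R, \forall eta \near 0^'+, eta / gamma eta <= C') :
  rnorm (tikhonov (alpha_star p.1 p.2) (A_ p.2) (y_ p.1) - xdag)
    @[p --> (0^'+, 0^'+)] --> (0 : R).
Proof.
have [L0 L0_ge0 A_bd] := linear_rnorm_bound A_bounded.
have AS := adjointP A_bounded.
have TS eta : 0 < eta -> adjoint_pair (A_ eta) (adjoint (A_ eta)).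
  by move=> eta0; apply: adjointP; exact: A_eta_bounded.
have AT eta : 0 < eta -> forall x, rnorm (A x - A_ eta x) <= eta * rnorm x.
  move=> eta0 x; rewrite rnormC.
  have [L1 L1_ge0 T_bd] := linear_rnorm_bound (A_eta_bounded eta eta0).
  apply: (@opnorm_bound _ _ _ _ (A_ eta \- A) (L1 + L0)) (A_noise eta eta0) x.
    by move=> a x; rewrite linearZ.
  by move=> x /=; rewrite mulrDl (le_trans (ler_rnormD _ _))// rnormN lerD.
(* One bound for [A] and for all [A_ eta] with [eta <= 1]. *)
pose L := L0 + 1; have L_ge0 : 0 <= L by rewrite addr_ge0.
have A_bound x : rnorm (A x) <= L * rnorm x.
  by rewrite (le_trans (A_bd x))// ler_wpM2r ?rnorm_ge0// lerDl.
have T_bound eta : 0 < eta -> eta <= 1 -> forall x, rnorm (A_ eta x) <= L * rnorm x.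
  move=> eta0 eta1 x; rewrite -[A_ eta x](subKr (A x)) mulrDl.
  rewrite (le_trans (ler_rnormD _ _))// rnormN lerD// (le_trans (AT _ eta0 x))//.
  by rewrite ler_wpM2r ?rnorm_ge0.
have [Cnc [Cnc0 noise]] := noise_condition.
have [C [C0 data]] := data_lower_bound.
have [C' etaC'] := eta_gamma.
set Fl := filter_prod (0 : R)^'+ (0 : R)^'+.
have near1 (Q : R -> Prop) : (\forall d \near (0 : R)^'+, Q d) -> \forall p \near Fl, Q p.1.
  by move=> hQ; exact: (cvg_fst hQ).
have near2 (Q : R -> Prop) : (\forall d \near (0 : R)^'+, Q d) -> \forall p \near Fl, Q p.2.
  by move=> hQ; exact: (cvg_snd hQ).
have lt1 c : 0 < c -> \forall p \near Fl, p.1 < c.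
  by move=> c0; apply: (near1 (fun d => d < c)); exact: nbhs_right_lt.
have lt2 c : 0 < c -> \forall p \near Fl, p.2 < c.
  by move=> c0; apply: (near2 (fun d => d < c)); exact: nbhs_right_lt.
have pos1 : \forall p \near Fl, 0 < p.1.
  by apply: (near1 (fun d => 0 < d)); exact: nbhs_right_gt.
have pos2 : \forall p \near Fl, 0 < p.2.
  by apply: (near2 (fun d => 0 < d)); exact: nbhs_right_gt.
have gamma_lt c : 0 < c -> \forall p \near Fl, gamma p.2 < c.
  by move=> c0; apply: (near2 (fun d => gamma d < c)); exact: cvgr_lt gamma_to0 _ c0.
have rho_lt c : 0 < c -> \forall p \near Fl, p.2 / Num.sqrt (gamma p.2) < c.
  move=> c0; apply: (near2 (fun d => d / Num.sqrt (gamma d) < c)).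
  exact: cvgr_lt eta_sqrt_gamma _ c0.
have source tau : 0 < tau -> exists w, rnorm (xdag - adjoint A w) <= tau.
  move=> tau0; have [w hw] := range_adjoint_dense AS A_inj xdag tau0.
  by exists w; exact: ltW.
have z_noise delta : 0 < delta -> rnorm (y_ delta - A xdag) <= delta.
  by move=> delta0; rewrite -attainable; exact: y_noise.
have psi_small e : 0 < e -> \forall p \near Fl,
    psi h (alpha_star p.1 p.2) (A_ p.2) (y_ p.1) < e.
  move=> e0; have [|w hw] := source (e / 8); first by rewrite divr_gt0.
  (* Once [w] is fixed, [m] makes [(m + m) * (rnorm w + 1)] equal to [e / 8]. The terms of
     [psi_argmin] then add up to at most 6/8 of [e]. *)
  pose m := e / (16 * (rnorm w + 1)).
  pose K := rnorm xdag + D * (rnorm y + 2).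
  have w1 : 0 < rnorm w + 1 by rewrite ltr_wpDl ?rnorm_ge0.
  have K_ge0 : 0 <= K.
    by rewrite addr_ge0 ?rnorm_ge0// mulr_ge0 ?(ltW D_gt0)// addr_ge0 ?rnorm_ge0.
  have m0 : 0 < m by rewrite divr_gt0 // mulr_gt0.
  have K1 : 0 < K + 1 by rewrite ltr_wpDl.
  near=> p.
  have d0 : 0 < p.1 by near: p; exact: pos1.
  have eta0 : 0 < p.2 by near: p; exact: pos2.
  have d1 : p.1 < 1 by near: p; exact: lt1.
  have eta1 : p.2 < 1 by near: p; exact: lt2.
  have damax : p.1 < alpha_max by near: p; exact: lt1.
  have dm : p.1 < m ^+ 2 by near: p; apply: lt1; rewrite exprn_gt0.
  have de : p.1 < (e / 8) ^+ 2 by near: p; apply: lt1; rewrite exprn_gt0 // divr_gt0.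
  have em : p.2 < m by near: p; exact: lt2.
  have gm : gamma p.2 < m ^+ 2 by near: p; apply: gamma_lt; rewrite exprn_gt0.
  have rm : p.2 / Num.sqrt (gamma p.2) < e / 8 / (K + 1).
    by near: p; apply: rho_lt; rewrite !divr_gt0.
  have /andP[g0 gmax] := gamma_range p.2 eta0.
  (* The competitor is admissible since it is at least gamma, dominates delta to tame the noise, and
     tends to 0 by [gamma_to0]. *)
  pose b := Num.max (gamma p.2) p.1.
  have gb : gamma p.2 <= b by rewrite le_max lexx.
  have db : p.1 <= b by rewrite le_max lexx orbT.
  have bmax : b <= alpha_max by rewrite ge_max gmax ltW.
  have := psi_argmin AS (TS _ eta0) g0 L_ge0 (ltW eta0) (ltW D_gt0)
    (T_bound _ eta0 (ltW eta1)) (AT _ eta0) hw d0 (z_noise _ d0)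
    (alpha_starP _ _ d0 eta0) gb db bmax.
  have sb : Num.sqrt b < m by apply: sqrtr_lt => //; rewrite gt_max gm dm.
  have sd : Num.sqrt p.1 < e / 8 by apply: sqrtr_lt => //; rewrite divr_gt0.
  have yz : rnorm (y_ p.1) <= rnorm y + 1.
    have := ler_rnormD (y_ p.1 - y) y; rewrite subrK => /le_trans; apply.
    by rewrite addrC lerD2l (le_trans (y_noise _ d0))// ltW.
  have rho0 : 0 <= p.2 / Num.sqrt (gamma p.2) by rewrite divr_ge0 ?sqrtr_ge0// ltW.
  have k1 : (rnorm xdag + D * (rnorm (y_ p.1) + 1)) * (p.2 / Num.sqrt (gamma p.2)) <= e / 8.
    apply: (@le_trans _ _ ((K + 1) * (e / 8 / (K + 1)))); last first.
      by rewrite mulrC divfK // lt0r_neq0.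
    apply: ler_pM => //; last exact: ltW.
      by rewrite addr_ge0 ?rnorm_ge0// mulr_ge0 ?(ltW D_gt0)// addr_ge0 ?rnorm_ge0.
    by have := ler_wpM2l (ltW D_gt0) yz; rewrite /K; lra.
  have k2 : (p.2 + Num.sqrt b) * rnorm w <= e / 8.
    apply: (@le_trans _ _ ((m + m) * (rnorm w + 1))); last first.
      by rewrite /m [leLHS](_ : _ = e / 8) //; field; rewrite lt0r_neq0.
    apply: ler_pM; rewrite ?rnorm_ge0 ?addr_ge0 ?sqrtr_ge0 ?(ltW eta0) ?lerDl//.
    by rewrite lerD // ltW.
  by move: sd k1 k2; lra.
have alpha_ge delta eta : 0 < delta -> 0 < eta ->
    gamma eta <= alpha_star delta eta <= alpha_max.
  by move=> d0 eta0; have [+ _] := alpha_starP _ _ d0 eta0; rewrite /= in_itv.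
have alpha_small e : 0 < e -> \forall p \near Fl, alpha_star p.1 p.2 < e.
  (* [K] dominates the factor in [psi_lower] for all admissible parameters. A parameter of at least
     [e] would keep psi above [Num.sqrt e * e * C / K]. *)
  move=> e0; pose K := (1 + alpha_max) * (L ^+ 2 + alpha_max) ^+ 2.
  have amax0 := ltW alpha_max_gt0.
  have K0 : 0 < K.
    by rewrite mulr_gt0 ?exprn_gt0 ?ltr_wpDl ?ltr_pwDl ?sqr_ge0.
  near=> p.
  have d0 : 0 < p.1 by near: p; exact: pos1.
  have eta0 : 0 < p.2 by near: p; exact: pos2.
  have eta1 : p.2 < 1 by near: p; exact: lt2.
  have ps : psi h (alpha_star p.1 p.2) (A_ p.2) (y_ p.1) < Num.sqrt e * e * C / K.
    by near: p; apply: psi_small; rewrite divr_gt0 // !mulr_gt0 // sqrtr_gt0.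
  rewrite ltNge; apply/negP => ea.
  have /andP[ga am] := alpha_ge _ _ d0 eta0.
  move: ps; set a := alpha_star p.1 p.2 in ea ga am *; move=> ps.
  have a0 : 0 < a by apply: lt_le_trans ea.
  have := psi_lower (TS _ eta0) a0 L_ge0 (T_bound _ eta0 (ltW eta1)) h (y_ p.1).
  have dat : C <= match h with HD | HR => rnorm (y_ p.1)
                  | QO => rnorm (adjoint (A_ p.2) (y_ p.1)) end.
    by have := data _ _ d0 eta0; case: (h).
  move: (match h with HD | HR => _ | QO => _ end) dat => N dat.
  apply/negP; rewrite -ltNge.
  apply: (@le_lt_trans _ _ (K * psi h a (A_ p.2) (y_ p.1))).
    rewrite ler_wpM2r ?psi_ge0// /K; apply: ler_pM.
    - by rewrite addr_ge0 // ltW.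
    - by rewrite sqr_ge0.
    - by rewrite lerD2l.
    - have La : 0 <= L ^+ 2 + a by rewrite addr_ge0 ?sqr_ge0 // ltW.
      by rewrite ler_pXn2r ?nnegrE ?lerD2l// (le_trans La)// lerD2l.
  rewrite mulrC -ltr_pdivlMr//; apply: (lt_le_trans ps).
  rewrite ler_pM2r ?invr_gt0//; apply: ler_pM => //.
  - by rewrite mulr_ge0 ?sqrtr_ge0 // ltW.
  - exact: ltW.
  - by apply: ler_pM; rewrite ?sqrtr_ge0 ?(ltW e0) ?ler_wsqrtr.
apply/cvgrPdist_lt => e e0.
(* [K1], [K2] and [K3] come from the coefficients in [tikhonov_error]; its terms will total at most
   5/8 of [e]. [K3] uses the absolute value because [C'] has no assumed sign. *)
pose K1 := 4 * Cnc + 1; have K1_gt0 : 0 < K1 by rewrite ltr_wpDl // mulr_ge0 // ltW.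
pose K2 := (2 * Cnc + 1) * rnorm xdag.
have K2_ge0 : 0 <= K2 by rewrite mulr_ge0 ?rnorm_ge0// addr_ge0// mulr_ge0 // ltW.
pose K3 := (5 * Cnc + 3) * `|C'|.
have K3_ge0 : 0 <= K3 by rewrite mulr_ge0// addr_ge0// mulr_ge0 // ltW.
have [|w hw] := source (e / 8 / K1); first by rewrite !divr_gt0.
pose m := e / (16 * K1 * (rnorm w + 1)).
have w1 : 0 < rnorm w + 1 by rewrite ltr_wpDl ?rnorm_ge0.
have m0 : 0 < m by rewrite divr_gt0 // !mulr_gt0.
near=> p.
have d0 : 0 < p.1 by near: p; exact: pos1.
have eta0 : 0 < p.2 by near: p; exact: pos2.
have eta1 : p.2 < 1 by near: p; exact: lt2.
have em : p.2 < m by near: p; exact: lt2.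
have r1 : p.2 / Num.sqrt (gamma p.2) < 1 by near: p; exact: rho_lt.
have r2 : p.2 / Num.sqrt (gamma p.2) < e / 8 / (K2 + 1).
  by near: p; apply: rho_lt; rewrite !divr_gt0 // ltr_wpDl.
have dK : p.1 < e / 8 / (K3 + 1).
  by near: p; apply: lt1; rewrite !divr_gt0 // ltr_wpDl.
have gC : p.2 / gamma p.2 <= C' by near: p; apply: (near2 (fun d => d / gamma d <= C')).
have am : alpha_star p.1 p.2 < m ^+ 2 by near: p; apply: alpha_small; rewrite exprn_gt0.
have ps : psi h (alpha_star p.1 p.2) (A_ p.2) (y_ p.1) < e / 8 / (2 * Cnc).
  by near: p; apply: psi_small; rewrite !divr_gt0 // mulr_gt0.
rewrite sub0r normrN ger0_norm ?rnorm_ge0//.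
have /andP[g0 gmax] := gamma_range p.2 eta0.
have /andP[ga amax] := alpha_ge _ _ d0 eta0.
set a := alpha_star p.1 p.2 in am ps ga amax *.
have a0 : 0 < a by apply: lt_le_trans ga.
have sg0 : 0 < Num.sqrt (gamma p.2) by rewrite sqrtr_gt0.
have sa0 : 0 < Num.sqrt a by rewrite sqrtr_gt0.
have ra : p.2 / Num.sqrt a <= p.2 / Num.sqrt (gamma p.2).
  by rewrite ler_wpM2l ?(ltW eta0)// lef_pV2 ?posrE// ler_wsqrtr.
(* Since gamma is at most [a], eta / sqrt a is at most eta / sqrt gamma, which is below 1 here. *)
have eta_a : p.2 ^+ 2 <= a.
  rewrite -[leRHS](@sqr_sqrtr R) ?(ltW a0)// ler_pXn2r ?nnegrE ?(ltW eta0) ?sqrtr_ge0//.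
  by rewrite -[leRHS]mul1r -ler_pdivrMr// (le_trans ra)// ltW.
have noise_a : rnorm (tikhonov a A (y_ p.1 - A xdag)) <= Cnc * psi h a A (y_ p.1 - A xdag).
  by rewrite -attainable; apply: noise => //; rewrite a0.
have := tikhonov_error AS (TS _ eta0) a0 L_ge0 (ltW eta0) A_bound
  (T_bound _ eta0 (ltW eta1)) (AT _ eta0) hw eta_a (ltW Cnc0) (z_noise _ d0) noise_a.
have k1 : 2 * Cnc * psi h a (A_ p.2) (y_ p.1) <= e / 8.
  by rewrite mulrC -ler_pdivlMr ?mulr_gt0// ltW.
have sa : Num.sqrt a < m by exact: sqrtr_lt.
have k2 : K1 * (e / 8 / K1 + (p.2 + Num.sqrt a) * rnorm w) <= e / 8 + e / 8.
  rewrite mulrDr; apply: lerD; first by rewrite mulrC divfK // lt0r_neq0.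
  apply: (@le_trans _ _ (K1 * ((m + m) * (rnorm w + 1)))).
    rewrite ler_wpM2l ?(ltW K1_gt0)//.
    apply: ler_pM; rewrite ?rnorm_ge0 ?addr_ge0 ?sqrtr_ge0 ?(ltW eta0) ?lerDl//.
    by rewrite lerD // ltW.
  by rewrite /m [leLHS](_ : _ = e / 8) //; field; rewrite !lt0r_neq0.
have k3 : (2 * Cnc + 1) * (p.2 / Num.sqrt a * rnorm xdag) <= e / 8.
  rewrite mulrCA mulrC -/K2.
  apply: (@le_trans _ _ ((K2 + 1) * (e / 8 / (K2 + 1)))); last first.
    by rewrite mulrC divfK // lt0r_neq0 // ltr_wpDl.
  apply: ler_pM; rewrite ?lerDl//; first by rewrite divr_ge0 ?sqrtr_ge0 // ltW.
  exact: le_trans ra (ltW r2).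
(* Here (iv) enters: eta / a is at most eta / gamma, hence bounded, and the factor delta supplies
   the decay. *)
have k4 : (5 * Cnc + 3) * (p.2 / a * p.1) <= e / 8.
  apply: (@le_trans _ _ (K3 * p.1)).
    rewrite /K3 -[leRHS]mulrA ler_wpM2l//; first by rewrite addr_ge0// mulr_ge0// ltW.
    rewrite ler_wpM2r ?(ltW d0)// (le_trans _ (le_trans gC (ler_norm _)))//.
    by rewrite ler_wpM2l ?(ltW eta0)// lef_pV2 ?posrE.
  apply: (@le_trans _ _ ((K3 + 1) * (e / 8 / (K3 + 1)))); last first.
    by rewrite mulrC divfK // lt0r_neq0 // ltr_wpDl.
  by apply: ler_pM; rewrite ?lerDl ?(ltW d0) ?(ltW dK).
by rewrite -/K1; move: k1 k2 k3 k4; lra.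
Unshelve. all: by end_near.
Qed.
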